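(* Let $J\subseteq E$ be a graded ideal. Then there exists a non-empty Zariski-open set $U\subseteq \mathrm{GL}_n(K)$ such that $$\alpha_{i,j}(\gamma(e_1,\ldots,e_n);E/J)=\alpha_{i,j}(e_1,\ldots,e_n;E/\operatorname{gin}_{<_{\mathrm{rlex}}}(J))$$ for all $1\le i\le n$, all $j\in\mathbb{Z}$ and all $\gamma=(\gamma_{k,l})_{1\leq k,l\leq n}\in U$, where $\gamma(e_1,\ldots ,e_n)=(\gamma_{1,1}e_1+\cdots +\gamma_{n,1}e_n,\ldots,\gamma_{1,n}e_1+\cdots +\gamma_{n,n}e_n)$.
   Context: $K$ is an infinite field and $E=K\langle e_1,\ldots,e_n\rangle$ is the standard graded exterior algebra. $\mathcal{M}$ is the category of finitely generated graded left and right $E$-modules $M$ with $am=(-1)^{\deg a\deg m}ma$ for homogeneous $a\in E$, $m\in M$. For $M\in\mathcal{M}$ and $v\in E_1$, $H^j(M,v)$ denotes the homology at $M_j$ of the complex $$\cdots\to M_{j-1}\xrightarrow{\cdot v}M_j\xrightarrow{\cdot v}M_{j+1}\to\cdots .$$ For a basis $v_1,\dots,v_n$ of $E_1$, the exterior annihilator numbers of $M$ with respect to $v_1,\dots,v_n$ are $$\alpha_{i,j}(v_1,\dots,v_n;M)=\dim_KH^j(M/(v_1,\dots,v_{i-1})M,v_i),\qquad 1\le i\le n,\ j\in\mathbb{Z}.$$ $<_{\mathrm{rlex}}$ denotes the reverse lexicographic order on monomials $e_F=e_{i_1}\wedge\dots\wedge e_{i_r}$ ($F=\{i_1<\dots<i_r\}$)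 with respect to $e_1<\dots<e_n$: among monomials of the same degree, $e_A<_{\mathrm{rlex}}e_B$ iff $\min((A\setminus B)\cup(B\setminus A))\in A$. $\operatorname{gin}_{<_{\mathrm{rlex}}}(J)$ is the generic initial ideal of $J$, i.e. the common value of the initial ideals $\operatorname{in}_{<_{\mathrm{rlex}}}(\varphi(J))$ for $\varphi$ in a suitable non-empty Zariski-open subset of $\mathrm{GL}_n(K)$ (acting on $E$ by linear changes of coordinates). *)

(* Defs.v *)
From HB Require Import structures.
From mathcomp Require Import all_boot all_order all_algebra all_field.
From mathcomp Require Import ring mpoly.
From mathcomp Require boolp classical_sets cardinality.

Set Implicit Arguments.
Unset Strict Implicit.
Unset Printing Implicit Defensive.

Import GRing.Theory.
Local Open Scope ring_scope.

(* The exterior algebra [K<e_1, ..., e_n>]. An element is its family of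
   coordinates on the monomials [e_A], where [A] is a subset of ['I_n] and
   [e_A] is the product of the [e_i], [i] in [A], in increasing order; see
   [mon_prod]. *)
Definition ext (K : fieldType) (n : nat) : Type := {ffun {set 'I_n} -> K^o}.

HB.instance Definition _ (K : fieldType) (n : nat) :=
  Vector.copy (ext K n) {ffun {set 'I_n} -> K^o}.

Section ExteriorAlgebra.
Variables (K : fieldType) (n : nat).
Local Notation E := (ext K n).
Implicit Types (x y z : E) (A B C D : {set 'I_n}).

Definition coord x A : K := (x : {ffun {set 'I_n} -> K^o}) A.

Definition mkext (f : {set 'I_n} -> K) : E :=
  [ffun A => f A] : {ffun {set 'I_n} -> K^o}.

Definition mon A : E := mkext (fun B => (B == A)%:R).

Definition inversions A B : nat :=
  (\sum_(a in A) \sum_(b in B) (b < a : nat))%N.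

Definition esign A B : K := (-1) ^+ inversions A B.

(* The bilinear extension of [e_A e_B = esign A B e_(A :|: B)] for disjoint
   [A] and [B], and [e_A e_B = 0] otherwise. *)
Definition emul x y : E :=
  mkext (fun C => \sum_(A : {set 'I_n} | A \subset C)
                     esign A (C :\: A) * coord x A * coord y (C :\: A)).

Lemma coordK f A : coord (mkext f) A = f A.
Proof. by rewrite /coord ffunE. Qed.

Lemma extP x y : (forall A, coord x A = coord y A) -> x = y.
Proof. by move=> h; apply/ffunP. Qed.

Lemma coordD x y A : coord (x + y) A = coord x A + coord y A.
Proof. by rewrite /coord !ffunE. Qed.

Lemma coordZ a x A : coord (a *: x) A = a * coord x A.
Proof. by rewrite /coord !ffunE. Qed.

Lemma coord0 A : coord (0 : E) A = 0.
Proof. by rewrite /coord !ffunE. Qed.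

Lemma coord_sum I (r : seq I) (P : pred I) (F : I -> E) A :
  coord (\sum_(i <- r | P i) F i) A = \sum_(i <- r | P i) coord (F i) A.
Proof.
by elim/big_rec2: _ => [|i y x _ <-]; rewrite ?coord0 ?coordD.
Qed.

Lemma coord_mon A B : coord (mon A) B = (B == A)%:R.
Proof. exact: coordK. Qed.

Lemma inversions0l B : inversions set0 B = 0%N.
Proof. by rewrite /inversions big_set0. Qed.

Lemma inversions0r A : inversions A set0 = 0%N.
Proof. by rewrite /inversions big1 // => a _; rewrite big_set0. Qed.

Lemma inversionsUl A B C :
  [disjoint A & B] -> inversions (A :|: B) C = (inversions A C + inversions B C)%N.
Proof.
by move=> d; rewrite /inversions -bigU //; apply: eq_bigl => a; rewrite !inE.
Qed.

Lemma inversionsUr A B C :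
  [disjoint B & C] -> inversions A (B :|: C) = (inversions A B + inversions A C)%N.
Proof.
move=> d; rewrite /inversions -big_split; apply: eq_bigr => a _.
by rewrite -bigU //; apply: eq_bigl => b; rewrite !inE.
Qed.

Lemma inversionsC A B :
  [disjoint A & B] -> (inversions A B + inversions B A = #|A| * #|B|)%N.
Proof.
move=> d; rewrite /inversions [X in (_ + X)%N]exchange_big /= -big_split /=.
rewrite -sum_nat_const; apply: eq_bigr => a aA; rewrite -big_split /= -sum1_card.
apply: eq_bigr => b bB. case: ltngtP => [_|_|/ord_inj eba] //.
by move: (disjointFr d aA); rewrite -eba bB.
Qed.

Lemma setUDK A C : A \subset C -> A :|: (C :\: A) = C.
Proof.
move=> s; apply/setP => i; rewrite !inE.
by have := subsetP s i; case: (i \in A) => [->|].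
Qed.

Lemma disjointD A C : [disjoint A & C :\: A].
Proof. by rewrite disjoint_sym -setI_eq0 setIC setIDA setDIl setDv set0I . Qed.

Lemma emulA : associative emul.
Proof.
move=> x y z; apply: extP => D; rewrite !coordK.
have -> : \sum_(A : {set 'I_n} | A \subset D)
    esign A (D :\: A) * coord x A * coord (emul y z) (D :\: A) =
  \sum_(A : {set 'I_n} | A \subset D)
    \sum_(C : {set 'I_n} | (C \subset D) && (A \subset C))
    esign A (D :\: A) * coord x A * (esign (C :\: A) (D :\: C)
       * coord y (C :\: A) * coord z (D :\: C)).
  apply: eq_bigr => A sAD; rewrite coordK big_distrr /=.
  rewrite (reindex_onto (fun C => C :\: A) (fun B => A :|: B)) /=; last first.
    move=> B sBD; apply/setP => i; rewrite !inE.
    have := subsetP sBD i; rewrite !inE.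
    by case: (i \in A) (i \in B) => [] [] // /(_ isT).
  apply: eq_big => C.
    apply/andP/andP => [[s /eqP e]|[sCD sAC]].
      split; last by rewrite -e subsetUl.
      by rewrite -e subUset sAD (subset_trans s) // subsetDl.
    by rewrite setSD // setUDK // eqxx.
  move=> /andP[s /eqP e]; suff -> : (D :\: A) :\: (C :\: A) = D :\: C by [].
  by rewrite setDDl e.
rewrite (exchange_big_dep (fun C => C \subset D)) /=; last by move=> A C _ /andP[].
apply: eq_bigr => C sCD; rewrite coordK big_distrr big_distrl /=.
apply: eq_big => A.
  by rewrite sCD /= andb_idl // => /subset_trans; apply.
move=> /andP[sAD /andP[_ sAC]].
rewrite !mulrA; congr (_ * _); rewrite [RHS]mulrAC.
have -> : esign A (D :\: A) = esign A (C :\: A) * esign A (D :\: C).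
  have d : [disjoint C :\: A & D :\: C].
    by apply: disjointWl (disjointD C D); apply: subsetDl.
  rewrite /esign -exprD -inversionsUr //.
  congr (_ ^+ inversions _ _); apply/setP => i; rewrite !inE.
  move: (subsetP sAC i) (subsetP sCD i).
  by move: (i \in A) (i \in C) (i \in D) => [] [] [] h1 h2 //;
    first [have := h1 isT | have := h2 isT].
have -> : esign C (D :\: C) = esign A (D :\: C) * esign (C :\: A) (D :\: C).
  by rewrite /esign -exprD -inversionsUl ?disjointD // setUDK.
by ring.
Qed.

Lemma esign0l B : esign set0 B = 1.
Proof. by rewrite /esign inversions0l. Qed.

Lemma esign0r A : esign A set0 = 1.
Proof. by rewrite /esign inversions0r. Qed.

Lemma emul1l : left_id (mon set0) emul.
Proof.
move=> x; apply: extP => C; rewrite coordK (bigD1 set0) ?sub0set //= big1.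
  by rewrite coord_mon eqxx esign0l setD0 !mul1r addr0.
by move=> A /andP[_ /negPf A0]; rewrite coord_mon A0 mulr0 mul0r.
Qed.

Lemma emul1r : right_id (mon set0) emul.
Proof.
move=> x; apply: extP => C; rewrite coordK (bigD1 C) //= big1.
  by rewrite setDv coord_mon eqxx esign0r mulr1 mul1r addr0.
move=> A /andP[sAC nAC]; rewrite coord_mon setD_eq0 [C \subset A](negPf _) ?mulr0 //.
by apply: contra nAC => sCA; rewrite eqEsubset sAC.
Qed.

Lemma emulDl : left_distributive emul +%R.
Proof.
move=> x y z; apply: extP => C; rewrite coordD !coordK -big_split /=.
by apply: eq_bigr => A _; rewrite coordD mulrDr mulrDl.
Qed.

Lemma emulDr : right_distributive emul +%R.
Proof.
move=> x y z; apply: extP => C; rewrite coordD !coordK -big_split /=.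
by apply: eq_bigr => A _; rewrite coordD mulrDr.
Qed.

Lemma mon0_neq0 : mon set0 != 0.
Proof.
apply/eqP => /(congr1 (coord^~ set0)) /eqP.
by rewrite /= coord_mon coord0 eqxx oner_eq0.
Qed.

HB.instance Definition _ := GRing.Zmodule_isNzRing.Build (ext K n)
  emulA emul1l emul1r emulDl emulDr mon0_neq0.

Lemma escaleAl (a : K) x y : a *: (x * y) = (a *: x) * y.
Proof.
apply: extP => C; rewrite coordZ !coordK big_distrr /=.
by apply: eq_bigr => A _; rewrite coordZ !mulrA [a * _]mulrC.
Qed.

HB.instance Definition _ := GRing.Lmodule_isLalgebra.Build K (ext K n) escaleAl.

Lemma escaleAr (a : K) x y : a *: (x * y) = x * (a *: y).
Proof.
apply: extP => C; rewrite coordZ !coordK big_distrr /=.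
by apply: eq_bigr => A _; rewrite coordZ mulrCA.
Qed.

HB.instance Definition _ := GRing.Lalgebra_isAlgebra.Build K (ext K n) escaleAr.
HB.instance Definition _ := Algebra_isFalgebra.Build K (ext K n).

Lemma coordM x y C :
  coord (x * y) C = \sum_(A : {set 'I_n} | A \subset C)
                       esign A (C :\: A) * coord x A * coord y (C :\: A).
Proof. exact: coordK. Qed.

Lemma emul1E : 1 = mon set0.
Proof. by []. Qed.

Lemma mon_mul A B :
  mon A * mon B = if [disjoint A & B] then esign A B *: mon (A :|: B) else 0.
Proof.
apply: extP => C; rewrite coordM; have [sAC|nAC] := boolP (A \subset C).
  rewrite (bigD1 A) //= big1 => [|D /andP[_ /negPf nDA]]; last first.
    by rewrite coord_mon nDA mulr0 mul0r.
  rewrite addr0 2!coord_mon eqxx mulr1.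
  have [<-|nB] := eqVneq (C :\: A) B.
    by rewrite disjointD setUDK // coordZ coord_mon eqxx.
  rewrite mulr0; case: ifPn => [d|]; rewrite ?coord0 //.
  rewrite coordZ coord_mon; have [eC|] := eqVneq C (A :|: B); last by rewrite mulr0.
  case/eqP: nB; rewrite eC setDUl setDv set0U.
  by apply/setDidPl; rewrite disjoint_sym.
rewrite big1 => [|D sDC].
  case: ifPn => [_|]; rewrite ?coord0 //.
  rewrite coordZ coord_mon; have [eC|] := eqVneq C (A :|: B); last by rewrite mulr0.
  by rewrite eC subsetUl in nAC.
rewrite coord_mon; have [eD|] := eqVneq D A; last by rewrite mulr0 mul0r.
by rewrite -eD sDC in nAC.
Qed.

Lemma mon_prod A : mon A = \prod_(i <- enum A) mon [set i].
Proof.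
have so : sorted (fun i j : 'I_n => i < j)%N (enum A).
  change (sorted (relpre (val : 'I_n -> nat) ltn) (enum A)); rewrite -sorted_map.
  apply: (subseq_sorted ltn_trans (s2 := map (val : 'I_n -> nat) (enum 'I_n))).
    by rewrite map_subseq // enumT filter_subseq.
  by rewrite val_enum_ord iota_ltn_sorted.
rewrite -[in LHS](set_enum A); elim: (enum A) so => [|i s IHs] so.
  by rewrite big_nil set_nil.
rewrite big_cons -IHs ?(path_sorted so) // mon_mul.
have lt_i j : j \in s -> (i < j)%N.
  by apply: (allP (order_path_min _ so)) => a b c; apply: ltn_trans.
rewrite disjoints1 inE ifT; last by apply/negP => /lt_i; rewrite ltnn.
rewrite set_cons /esign /inversions big_set1 big1 ?scale1r // => j.
by rewrite inE => /lt_i ij; rewrite ltnNge (ltnW ij).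
Qed.

(* The component of degree [j]; it is zero for negative [j]. *)
Definition ecomp_fun (j : int) x : E :=
  mkext (fun A => if #|A|%:Z == j then coord x A else 0).

Lemma coord_ecomp_fun j x A :
  coord (ecomp_fun j x) A = if #|A|%:Z == j then coord x A else 0.
Proof. exact: coordK. Qed.

Lemma ecomp_fun_linear j : linear (ecomp_fun j).
Proof.
move=> a x y; apply: extP => A; rewrite coordD coordZ 3!coord_ecomp_fun coordD coordZ.
by case: ifP; rewrite ?mulr0 ?addr0.
Qed.

HB.instance Definition _ j :=
  GRing.isLinear.Build K E E *:%R (ecomp_fun j) (ecomp_fun_linear j).

Definition ecomp (j : int) : 'End(E) := linfun (ecomp_fun j).

Lemma coord_ecomp j x A :
  coord (ecomp j x) A = if #|A|%:Z == j then coord x A else 0.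
Proof. by rewrite lfunE coord_ecomp_fun. Qed.

End ExteriorAlgebra.

Arguments mon {K n}.

Section Grading.
Variables (K : fieldType) (V : vectType K).

(* A grading of [V] by the integers is given by its homogeneous component
   projections. *)
Definition grading (h : int -> 'End(V)) : Prop :=
  (forall i j x, h i (h j x) = if i == j then h j x else 0) /\
  (exists2 s : seq int, uniq s & forall x, x = \sum_(j <- s) h j x).

Lemma grading_memP (h : int -> 'End(V)) j x :
  grading h -> reflect (h j x = x) (x \in limg (h j)).
Proof.
case=> hh _; apply: (iffP memv_imgP) => [[y _ ->]|<-].
  by rewrite hh eqxx.
by exists x; rewrite ?memvf.
Qed.
End Grading.

(* The objects of the category M: finite-dimensional (equivalently, finitely
   generated) graded left and right [E]-modules with
   [a m = (-1)^(deg a deg m) m a]. *)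
Record emod (K : fieldType) (n : nat) := EMod {
  emod_sort :> vectType K;
  lact : ext K n -> 'End(emod_sort);
  ract : ext K n -> 'End(emod_sort);
  hcomp : int -> 'End(emod_sort);
  lact_linear : linear lact;
  ract_linear : linear ract;
  lact1 : forall m, lact 1 m = m;
  ract1 : forall m, ract 1 m = m;
  lactM : forall a b m, lact (a * b) m = lact a (lact b m);
  ractM : forall a b m, ract (a * b) m = ract b (ract a m);
  lractC : forall a b m, lact a (ract b m) = ract b (lact a m);
  hcomp_grading : grading hcomp;
  lact_deg : forall i j a m, a \in limg (ecomp K n i) ->
    m \in limg (hcomp j) -> lact a m \in limg (hcomp (i + j));
  ract_deg : forall i j a m, a \in limg (ecomp K n i) ->
    m \in limg (hcomp j) -> ract a m \in limg (hcomp (j + i));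
  act_sign : forall i j a m, a \in limg (ecomp K n i) ->
    m \in limg (hcomp j) -> lact a m = (-1) ^+ absz (i * j) *: ract a m
}.
Arguments lact {K n e} a : rename.
Arguments ract {K n e} a : rename.
Arguments hcomp {K n e} j : rename.


Section Modules.
Variables (K : fieldType) (n : nat).
Local Notation E := (ext K n).
Implicit Types (M : emod K n).

Definition hpart M (j : int) : {vspace M} := limg (hcomp j : 'End(M)).

Lemma ecomp_ecomp i j (x : E) :
  ecomp K n i (ecomp K n j x) = if i == j then ecomp K n j x else 0.
Proof.
apply: extP => A; rewrite 2!coord_ecomp.
case: (eqVneq i j) => [->|nij].
  by rewrite coord_ecomp; case: (_ == j).
by rewrite coord0; case: (_ =P i) => // ->; rewrite (negPf nij).
Qed.

Lemma ecomp_grading : grading (ecomp K n).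
Proof.
split; first exact: ecomp_ecomp.
exists (map Posz (iota 0 n.+1)); first by rewrite map_inj_uniq ?iota_uniq // => i j [].
move=> x; apply: extP => A; rewrite coord_sum big_map.
have An : (#|A| < n.+1)%N by rewrite ltnS -[n in leqRHS]card_ord max_card.
rewrite (bigD1_seq #|A|) ?iota_uniq ?mem_iota //= coord_ecomp eqxx big1 ?addr0 //.
move=> j nj; rewrite coord_ecomp; case: eqP => // -[e].
by rewrite e eqxx in nj.
Qed.

Lemma ecomp_mem (i : int) (x : E) :
  reflect (forall A : {set 'I_n}, #|A|%:Z != i -> coord x A = 0) (x \in limg (ecomp K n i)).
Proof.
apply: (iffP (grading_memP _ _ ecomp_grading)) => [<- A nA|h].
  by rewrite coord_ecomp (negPf nA).
by apply: extP => A; rewrite coord_ecomp; case: ifPn => // /h ->.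
Qed.

Lemma ecomp_mul i j (x y : E) : x \in limg (ecomp K n i) ->
  y \in limg (ecomp K n j) -> x * y \in limg (ecomp K n (i + j)).
Proof.
move=> /ecomp_mem hx /ecomp_mem hy; apply/ecomp_mem => C nC.
rewrite coordM big1 // => A sAC.
have [eA|/hx ->] := eqVneq #|A|%:Z i; last by rewrite mulr0 mul0r.
rewrite hy ?mulr0 //; apply: contra nC => /eqP <-; rewrite -eA -PoszD.
by rewrite cardsD (setIidPr sAC) subnKC ?subset_leq_card.
Qed.

Lemma ecomp_sign i j (x y : E) : x \in limg (ecomp K n i) ->
  y \in limg (ecomp K n j) -> x * y = (-1) ^+ absz (i * j) *: (y * x).
Proof.
move=> /ecomp_mem hx /ecomp_mem hy; apply: extP => C.
rewrite coordZ 2!coordM big_distrr /=.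
rewrite (reindex_onto (fun A => C :\: A) (fun A => C :\: A)) /=; last first.
  by move=> A sAC; rewrite setDDr setDv set0U (setIidPr sAC).
apply: eq_big => A.
  rewrite subsetDl /= setDDr setDv set0U.
  by apply/eqP/idP => [<-|/setIidPr //]; apply: subsetIl.
move=> /andP[_ /eqP e]; rewrite e.
have [eA|/hx ->] := eqVneq #|C :\: A|%:Z i; last by rewrite !(mulr0, mul0r).
have [eB|/hy ->] := eqVneq #|A|%:Z j; last by rewrite !(mulr0, mul0r).
rewrite -eA -eB -PoszM absz_nat -inversionsC; last first.
  by rewrite disjoint_sym disjointD.
rewrite exprD -/(esign K _ _) -/(esign K _ _).
suff: esign K A (C :\: A) * esign K A (C :\: A) = 1.
  by move=> s; rewrite !mulrA -[_ * _ * esign K A _]mulrA s mulr1 mulrAC.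
by rewrite /esign -expr2 sqrr_sign.
Qed.

Lemma amullE (a m : E) : amull a m = a * m.
Proof. by rewrite lfunE. Qed.

Lemma amulrE (a m : E) : amulr a m = m * a.
Proof. by rewrite lfunE. Qed.

Definition extM : emod K n.
Proof.
refine (@EMod K n (ext K n) (fun a => amull a) (fun a => amulr a) (@ecomp K n)
  _ _ _ _ _ _ _ ecomp_grading _ _ _).
- exact: linearP.
- exact: linearP.
- by move=> m; rewrite amullE mul1r.
- by move=> m; rewrite amulrE mulr1.
- by move=> a b m; rewrite 3!amullE mulrA.
- by move=> a b m; rewrite 3!amulrE mulrA.
- by move=> a b m; rewrite 2!amullE 2!amulrE mulrA.
- by move=> i j a m ha hm; rewrite amullE; apply: ecomp_mul.
- by move=> i j a m ha hm; rewrite amulrE; apply: ecomp_mul.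
- by move=> i j a m ha hm; rewrite amullE amulrE; apply: ecomp_sign.
Defined.
End Modules.

(* The quotient space [V / N], realized on a complement of [N]; see
   [qproj_surj] and [qproj_eq0]. *)
Section Quotient.
Variables (K : fieldType) (V : vectType K) (N : {vspace V}).

Definition quotv : vectType K := subvs_of (N^C)%VS.

Definition qproj : 'Hom(V, quotv) := linfun (vsproj (N^C)%VS \o (\1 - projv N)%VF).

Definition qrepr : 'Hom(quotv, V) := linfun (vsval : subvs_of (N^C)%VS -> V).

(* The map induced on the quotient by an endomorphism preserving [N]. *)
Definition qmap (f : 'End(V)) : 'End(quotv) := (qproj \o f \o qrepr)%VF.

Lemma qrepr_proj x : qrepr (qproj x) = x - projv N x.
Proof.
by rewrite !lfunE /= vsprojK !lfunE /= ?lfunE //; apply: memv_projC.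
Qed.

Lemma qreprK y : qproj (qrepr y) = y.
Proof.
apply: val_inj => /=; have -> : vsval (qproj (qrepr y)) = qrepr (qproj (qrepr y)).
  by rewrite [RHS]lfunE.
rewrite qrepr_proj lfunE /=.
suff -> : projv N (vsval y) = 0 by rewrite subr0.
have := memv_proj N (vsval y); have := memv_projC N (vsval y).
move=> h1 h2; apply/eqP; rewrite -memv0 -(capv_compl N) memv_cap h2.
by rewrite -(subKr (vsval y) (projv N _)) memvB ?subvsP.
Qed.

Lemma qproj_surj y : exists x, y = qproj x.
Proof. by exists (qrepr y); rewrite qreprK. Qed.

Lemma qproj_eq0 x : (qproj x == 0) = (x \in N).
Proof.
apply/eqP/idP => [h|xN].
  have := qrepr_proj x; rewrite h linear0 => /esym/eqP; rewrite subr_eq0 => /eqP ->.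
  exact: memv_proj.
by rewrite -[LHS]qreprK qrepr_proj projv_id // subrr linear0.
Qed.

Lemma qmapE f x : (f @: N <= N)%VS -> qmap f (qproj x) = qproj (f x).
Proof.
move=> fN; rewrite /qmap !comp_lfunE qrepr_proj; apply/eqP.
rewrite -subr_eq0 -linearB qproj_eq0 -linearB addrAC subrr sub0r linearN.
by rewrite memvN (subvP fN) // memv_img // memv_proj.
Qed.

Lemma qmap_linear : linear qmap.
Proof.
move=> a f g; apply/lfunP => y; rewrite add_lfunE scale_lfunE !comp_lfunE.
by rewrite add_lfunE scale_lfunE linearP.
Qed.
End Quotient.

Section QuotientModules.
Variables (K : fieldType) (n : nat).
Local Notation E := (ext K n).

Definition is_gsubmod (M : emod K n) (N : {vspace M}) : Prop :=
  [/\ forall a, (lact a @: N <= N)%VS,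
      forall a, (ract a @: N <= N)%VS
    & forall j, (hcomp j @: N <= N)%VS].

Record gsubmod (M : emod K n) := GSubmod {
  gsub_vs :> {vspace M};
  gsubP : is_gsubmod gsub_vs
}.

Lemma qmap_limg (M : emod K n) (N : gsubmod M) j y :
  reflect (exists2 x, x \in hpart M j & y = qproj N x)
          (y \in limg (qmap N (hcomp j))).
Proof.
have [_ _ hN] := gsubP N.
apply: (iffP memv_imgP) => [[z _ ->]|[x /memv_imgP[z _ ->] ->]].
  have [x ->] := qproj_surj z; exists (hcomp j x); last by rewrite qmapE.
  by rewrite memv_img ?memvf.
by exists (qproj N z); rewrite ?memvf // qmapE.
Qed.

Definition quotM (M : emod K n) (N : gsubmod M) : emod K n.
Proof.
refine (@EMod K n (quotv N) (fun a => qmap N (lact a)) (fun a => qmap N (ract a))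
  (fun j => qmap N (hcomp j)) _ _ _ _ _ _ _ _ _ _ _); have [lN rN hN] := gsubP N.
- by move=> c a b; rewrite lact_linear qmap_linear.
- by move=> c a b; rewrite ract_linear qmap_linear.
- by move=> y; have [x ->] := qproj_surj y; rewrite qmapE // lact1.
- by move=> y; have [x ->] := qproj_surj y; rewrite qmapE // ract1.
- by move=> a b y; have [x ->] := qproj_surj y; rewrite !qmapE // lactM.
- by move=> a b y; have [x ->] := qproj_surj y; rewrite !qmapE // ractM.
- by move=> a b y; have [x ->] := qproj_surj y; rewrite !qmapE // lractC.
- have [hh [s us hs]] := hcomp_grading M; split.
    move=> i j y; have [x ->] := qproj_surj y; rewrite !qmapE // hh.
    by case: ifP; rewrite ?linear0.
  exists s => // y; have [x ->] := qproj_surj y; rewrite {1}(hs x) linear_sum.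
  by apply: eq_bigr => j _; rewrite qmapE.
- move=> i j a y ha /qmap_limg[x hx ->]; apply/qmap_limg; rewrite qmapE //.
  by exists (lact a x) => //; apply: lact_deg.
- move=> i j a y ha /qmap_limg[x hx ->]; apply/qmap_limg; rewrite qmapE //.
  by exists (ract a x) => //; apply: ract_deg.
- move=> i j a y ha /qmap_limg[x hx ->]; rewrite !qmapE //.
  by rewrite (act_sign ha hx) linearZ.
Defined.
End QuotientModules.

Section Annihilator.
Variables (K : fieldType) (n : nat).
Local Notation E := (ext K n).

Definition E1 : vectType K := subvs_of (limg (ecomp K n 1)).

Lemma mon_mem (A : {set 'I_n}) : mon A \in limg (ecomp K n #|A|).
Proof.
apply/ecomp_mem => B nB; rewrite coord_mon; have [eBA|//] := eqVneq B A.
by rewrite eBA eqxx in nB.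
Qed.

Lemma evar_mem (i : 'I_n) : mon [set i] \in limg (ecomp K n 1).
Proof. by have := mon_mem [set i]; rewrite cards1. Qed.

Definition evar (i : 'I_n) : E1 := Subvs (evar_mem i).

(* [gamma (e_1, ..., e_n)]: the columns of [g] *)
Definition change_vars (g : 'M[K]_n) (l : 'I_n) : E1 := \sum_k g k l *: evar k.

Lemma mul_E1_swap (v : E1) (a : E) : exists b, a * vsval v = vsval v * b.
Proof.
have [_ [s _ hs]] := ecomp_grading K n.
exists (\sum_(j <- s) (-1) ^+ absz (j * 1) *: ecomp K n j a).
rewrite {1}(hs a) mulr_suml mulr_sumr; apply: eq_bigr => j _.
rewrite -scalerAr (@ecomp_sign _ _ j 1) ?subvsP //.
by rewrite memv_img ?memvf.
Qed.

Lemma hcomp_lact_E1 (M : emod K n) (v : E1) j (m : M) :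
  hcomp j (lact (vsval v) m) = lact (vsval v) (hcomp (j - 1) m).
Proof.
have hM := hcomp_grading M; have [hh [s us hs]] := hM.
rewrite {1 2}(hs m) !linear_sum; apply: eq_bigr => l _.
have /(grading_memP _ _ hM) e :
    lact (vsval v) (hcomp l m) \in limg (hcomp (1 + l) : 'End(M)).
  by apply: lact_deg; rewrite ?subvsP // memv_img ?memvf.
rewrite /= -e !hh e subr_eq addrC [_ + 1]addrC.
by case: ifP => _; rewrite ?e ?linear0.
Qed.

(* [(v_1, ..., v_(i-1)) M]; the index [i] starts at [0] here. *)
Definition Mideal (M : emod K n) (v : 'I_n -> E1) (i : 'I_n) : {vspace M} :=
  (\sum_(k < n | (k < i)%N) limg (lact (vsval (v k)) : 'End(M)))%VS.

Lemma MidealP (M : emod K n) (v : 'I_n -> E1) (i : 'I_n) :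
  is_gsubmod (Mideal M v i).
Proof.
suff st (f : 'End(M)) : (forall k m, exists m',
    f (lact (vsval (v k)) m) = lact (vsval (v k)) m') ->
    (f @: Mideal M v i <= Mideal M v i)%VS.
  split=> [a|a|j]; apply: st => k m.
  - have [b e] := mul_E1_swap (v k) a; exists (lact b m).
    by rewrite -!lactM e.
  - by exists (ract a m); rewrite lractC.
  - by exists (hcomp (j - 1) m); rewrite hcomp_lact_E1.
move=> h; rewrite limg_sum; apply/subv_sumP => k ki.
apply: subv_trans (sumv_sup k _ (subvv _)) => //.
apply/subvP => y /memv_imgP[x /memv_imgP[m _ ->] ->].
by have [m' ->] := h k m; rewrite memv_img ?memvf.
Qed.

Definition Mideal_sub (M : emod K n) (v : 'I_n -> E1) (i : 'I_n) : gsubmod M :=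
  GSubmod (MidealP M v i).

Definition cycles (M : emod K n) (v : E1) (j : int) : {vspace M} :=
  (hpart M j :&: lker (ract (vsval v) : 'End(M)))%VS.

Definition boundaries (M : emod K n) (v : E1) (j : int) : {vspace M} :=
  (ract (vsval v) @: hpart M (j - 1))%VS.

Lemma E1_sum (v : E1) : vsval v = \sum_i coord (vsval v) [set i] *: mon [set i].
Proof.
have /ecomp_mem hv : vsval v \in limg (ecomp K n 1) by apply: subvsP.
apply: extP => A; rewrite coord_sum.
have [/cards1P[i ->]|nA] := boolP (#|A| == 1%N).
  rewrite (bigD1 i) //= coordZ coord_mon eqxx mulr1 big1 ?addr0 // => k ki.
  rewrite coordZ coord_mon; have [/set1_inj e|] := eqVneq [set i] [set k].
    by rewrite e eqxx in ki.
  by rewrite mulr0.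
rewrite hv // big1 // => i _; rewrite coordZ coord_mon.
have [e|] := eqVneq A [set i]; last by rewrite mulr0.
by rewrite e cards1 in nA.
Qed.

Lemma E1_sqr0 (v : E1) : vsval v * vsval v = 0.
Proof.
rewrite (E1_sum v); set c := fun i : 'I_n => coord (vsval v) [set i].
pose m i : E := c i *: mon [set i].
have mm i : m i * m i = 0.
  rewrite -scalerAl -scalerAr mon_mul disjoints1 inE eqxx /=.
  by rewrite !scaler0.
have mC i j : m i * m j = - (m j * m i).
  have h k : m k \in limg (ecomp K n 1) by rewrite memvZ ?evar_mem.
  by rewrite (ecomp_sign (h i) (h j)) expr1 scaleN1r.
rewrite -[X in X * X]/(\sum_i m i).
have -> : (\sum_i m i) * (\sum_i m i) =
    \sum_(i < n) \sum_(j < n | (i < j)%N) (m i * m j + m j * m i).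
  rewrite mulr_suml; under eq_bigr do rewrite mulr_sumr.
  transitivity (\sum_(i < n) \sum_(j < n | (i < j)%N) m i * m j +
                \sum_(i < n) \sum_(j < n | (j < i)%N) m i * m j).
    rewrite -big_split /=; apply: eq_bigr => i _.
    rewrite (bigID (fun j : 'I_n => (i < j)%N)) /=; congr (_ + _).
    rewrite (bigID (fun j : 'I_n => j == i)) /= addrC [X in _ + X]big1 ?addr0 //.
      by apply: eq_bigl => j; rewrite -leqNgt ltn_neqAle andbC.
    by move=> j /andP[_ /eqP ->].
  rewrite [X in _ + X](exchange_big_dep predT) //= -big_split /=.
  by apply: eq_bigr => i _; rewrite -big_split.
by rewrite big1 // => i _; rewrite big1 // => j _; rewrite mC addNr.
Qed.

Lemma boundaries_cycles (M : emod K n) (v : E1) (j : int) :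
  (boundaries M v j <= cycles M v j)%VS.
Proof.
apply/subvP => _ /memv_imgP[x hx ->]; rewrite memv_cap memv_ker -ractM E1_sqr0.
rewrite -[j in hpart M j](subrK 1) ract_deg ?subvsP //=.
have := @ract_linear _ _ M (-1) 0 0; rewrite scaler0 addr0 scaleN1r addNr => ->.
by rewrite lfunE eqxx.
Qed.

Definition homology (M : emod K n) (v : E1) (j : int) : vectType K :=
  quotv (linfun (vsval : subvs_of (cycles M v j) -> M)
           @^-1: boundaries M v j)%VS.

(* The number alpha_(i+1,j)(v; M), [i] starting at [0]. The definition makes
   sense for any sequence [v]; it is meant for bases of [E1]. *)
Definition annihilator_number (v : 'I_n -> E1) (M : emod K n)
    (i : 'I_n) (j : int) : nat :=
  \dim {: homology (quotM (Mideal_sub M v i)) (v i) j}.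

(* Graded ideals of [E] are two-sided. *)
Definition gideal : Type := gsubmod (extM K n).

(* [rlex_lt A B]: [e_A] is smaller than [e_B], both of the same degree. *)
Definition rlex_lt (A B : {set 'I_n}) : bool :=
  let D := (A :\: B) :|: (B :\: A) in
  (#|A| == #|B|) && [exists i in D, (i \in A) && [forall k in D, (i <= k)%N]].

(* [e_A] is the initial monomial of [f], a nonzero homogeneous element. *)
Definition is_initial (f : E) (A : {set 'I_n}) : Prop :=
  [/\ exists j, f \in limg (ecomp K n j), coord f A != 0
    & forall B : {set 'I_n}, coord f B != 0 -> B != A -> rlex_lt B A].

Definition initial_mons (J : {vspace E}) : {set {set 'I_n}} :=
  [set A | boolp.asbool (exists2 f : E, f \in J & is_initial f A)].

Definition initial_ideal (J : {vspace E}) : {vspace E} :=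
  (fullv * <<[seq mon A | A in initial_mons J]>> * fullv)%VS.

(* The algebra endomorphism [e_l |-> \sum_k g k l *: e_k]. *)
Definition subst_fun (g : 'M[K]_n) (x : E) : E :=
  \sum_(A : {set 'I_n}) coord x A *: \prod_(i <- enum A) vsval (change_vars g i).

Lemma subst_linear g : linear (subst_fun g).
Proof.
move=> a x y; rewrite /subst_fun scaler_sumr -big_split /=.
by apply: eq_bigr => A _; rewrite coordD coordZ scalerDl scalerA.
Qed.

HB.instance Definition _ g :=
  GRing.isLinear.Build K E E *:%R (subst_fun g) (subst_linear g).

Definition subst (g : 'M[K]_n) : 'End(E) := linfun (subst_fun g).

Lemma change_vars1 l : change_vars 1%:M l = evar l.
Proof.
rewrite /change_vars (bigD1 l) //= mxE eqxx scale1r big1 ?addr0 // => k kl.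
by rewrite mxE (negPf kl) scale0r.
Qed.

Lemma subst1 x : subst 1%:M x = x.
Proof.
rewrite lfunE /= /subst_fun; apply: extP => B; rewrite coord_sum (bigD1 B) //=.
under eq_bigr do rewrite change_vars1.
rewrite -mon_prod coordZ coord_mon eqxx mulr1 big1 ?addr0 // => A AB.
under eq_bigr do rewrite change_vars1.
by rewrite -mon_prod coordZ coord_mon eq_sym (negPf AB) mulr0.
Qed.

(* Zariski-open subsets of [GL_n(K)]: its intersections with complements of
   common zero loci of polynomials in the [n * n] matrix entries. *)
Definition zariski_open_GL (U : 'M[K]_n -> Prop) : Prop :=
  exists S : {mpoly K[n * n]} -> Prop, forall g : 'M[K]_n,
    U g <-> g \in unitmx /\
            (exists2 p, S p & p.@[fun k => mxvec g 0 k] != 0).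

Definition is_gin (J I : {vspace E}) : Prop :=
  exists U : 'M[K]_n -> Prop,
    [/\ zariski_open_GL U, exists g, U g
      & forall g, U g -> initial_ideal (subst g @: J)%VS = I].

Definition gin_vs (J : {vspace E}) : {vspace E} :=
  classical_sets.xget 0%VS (is_gin J).

Definition gradedv (U : {vspace E}) := forall j, (ecomp K n j @: U <= U)%VS.

Lemma gradedv_prod U V : gradedv U -> gradedv V -> gradedv (U * V).
Proof.
move=> gU gV j; have gE := ecomp_grading K n; have [_ [s _ hs]] := gE.
have mU i u : u \in U -> ecomp K n i u \in U.
  by move=> uU; apply: (subvP (gU i)); rewrite memv_img.
have mV i u : u \in V -> ecomp K n i u \in V.
  by move=> uV; apply: (subvP (gV i)); rewrite memv_img.
apply/subvP => _ /memv_imgP[x xUV ->].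
suff /subvP/(_ _ xUV) : (U * V <= ecomp K n j @^-1: (U * V))%VS.
  by rewrite -memv_preim.
apply/prodvP => u w uU wV; rewrite -memv_preim.
rewrite (hs u) (hs w) mulr_suml linear_sum memv_suml // => i _.
rewrite mulr_sumr linear_sum memv_suml // => l _.
have /(grading_memP _ _ gE) e :
    ecomp K n i u * ecomp K n l w \in limg (ecomp K n (i + l)).
  by apply: ecomp_mul; rewrite memv_img ?memvf.
rewrite /= -e ecomp_ecomp e; case: ifP => _; last exact: mem0v.
by rewrite memv_mul ?mU ?mV.
Qed.

Lemma initial_idealP J : is_gsubmod (initial_ideal J : {vspace extM K n}).
Proof.
rewrite /initial_ideal; set X := <<_>>%VS.
have gf : gradedv fullv by move=> j; apply: subvf.
have gX : gradedv X.
  move=> j; rewrite limg_span; apply/span_subvP => _ /mapP[_ /imageP[A hA ->] ->].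
  have /(grading_memP _ _ (ecomp_grading K n)) e := mon_mem A.
  rewrite -e ecomp_ecomp e; case: ifP => _; last exact: mem0v.
  by rewrite memv_span // image_f.
split=> [a|a|j]; last by apply: gradedv_prod => //; apply: gradedv_prod.
  apply/subvP => _ /memv_imgP[x hx ->]; rewrite amullE.
  have : a * x \in (fullv * (fullv * X * fullv))%VS by rewrite memv_mul ?memvf.
  rewrite !prodvA; apply/subvP; do 2!apply: prodvSl.
  exact: subvf.
apply/subvP => _ /memv_imgP[x hx ->]; rewrite amulrE.
have : x * a \in (fullv * X * fullv * fullv)%VS by rewrite memv_mul ?memvf.
by rewrite -prodvA; apply/subvP/prodvSr/subvf.
Qed.

Lemma gin_vsP J : is_gsubmod (gin_vs J : {vspace extM K n}).
Proof.
rewrite /gin_vs; case: classical_sets.xgetP => [I _ [U [_ [g Ug] /(_ _ Ug) <-]]|_].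
  exact: initial_idealP.
by split=> ?; rewrite limg0 subvv.
Qed.

(* [gin J] is the common value of the initial ideals of [g J] for [g] in some
   nonempty Zariski-open set; it is unique when [K] is infinite. *)
Definition gin (J : gideal) : gideal := GSubmod (gin_vsP J).

End Annihilator.
Arguments evar {K n} i.

(* Main.v *)
Require Import Defs.
From HB Require Import structures.
From mathcomp Require Import all_boot all_algebra all_field.
From mathcomp Require Import mpoly.
From mathcomp Require boolp cardinality classical_sets.
(* [vector] also has a [coord]; the one of [Defs] is meant below. *)
Import Defs.

(* Write [Q_i = J + (v_1, ..., v_i)]. Rank-nullity for multiplication by [v_i]
   on [E / Q_(i-1)] expresses [alpha_(i,j)] through the dimensions of the graded
   pieces of [Q_(i-1)] and [Q_i] in degrees [j] and [j + 1] only. The automorphism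
   [e_l |-> v_l] replaces [v] by the variables and [J] by a coordinate change
   [I] of [J]. Modulo [e_1, ..., e_i] one keeps the coordinates on the [e_A]
   with [A] disjoint from [{1, ..., i}]; in each degree these [A] form an upper
   set for the reverse lexicographic order. For an upper set [S], the
   projection of [I] to the coordinates in [S] has as dimension the number of
   initial monomials in [S], so [I] and [in(I)] give the same dimensions.
   The generic initial ideal exists for the same reason: these dimensions are
   ranks of matrices depending polynomially on the coordinate change, hence
   generically constant, and they determine the initial monomials. *)

Set Implicit Arguments.
Unset Strict Implicit.
Unset Printing Implicit Defensive.

Import GRing.Theory.
Local Open Scope ring_scope.

(** * The reverse lexicographic order on sets of variables *)

Section Rlex.
Variable n : nat.
Implicit Types (A B C : {set 'I_n}).

Lemma rlex_ltP A B :
  reflect (#|A| = #|B| /\ exists m : 'I_n,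
             [/\ m \in A, m \notin B & forall k : 'I_n, (k < m)%N -> (k \in A) = (k \in B)])
          (rlex_lt A B).
Proof.
rewrite /rlex_lt; apply: (iffP andP) => [[/eqP cAB /existsP[m]]|[cAB [m [mA mB h]]]].
  move=> /andP[]; rewrite !inE => mD /andP[mA /forallP h]; split=> //; exists m; split=> //.
    by move: mD; rewrite mA; case: (m \in B).
  move=> k km; have /implyP := h k; rewrite !inE leqNgt km.
  by case: (k \in A) (k \in B) => [] [] // /(_ isT).
split; first exact/eqP; apply/existsP; exists m; rewrite !inE mA mB /=.
apply/forallP => k; apply/implyP; rewrite !inE leqNgt; apply: contraL => /h ->.
by case: (k \in B).
Qed.

Lemma rlex_lt_trans : transitive (@rlex_lt n).
Proof.
move=> B A C /rlex_ltP[cAB [m [mA mB hm]]] /rlex_ltP[cBC [p [pB pC hp]]].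
apply/rlex_ltP; split; first by rewrite cAB.
case: (ltngtP m p) => [mp|pm|/val_inj e]; last by rewrite e pB in mB.
  exists m; split=> // [|k km]; first by rewrite -hp.
  by rewrite hm // hp // (ltn_trans km).
exists p; split=> // [|k kp]; first by rewrite hm.
by rewrite hm ?hp // (ltn_trans kp).
Qed.

Lemma rlex_lt_irr A : rlex_lt A A = false.
Proof. by apply/rlex_ltP => -[_ [m [->]]]. Qed.

(** The least index at which the two sets differ decides the comparison. *)
Lemma rlex_lt_total A B : #|A| = #|B| -> A != B -> rlex_lt A B || rlex_lt B A.
Proof.
move=> cAB nAB; pose P (k : 'I_n) := (k \in A) != (k \in B).
have [m0 Pm0] : exists m, P m.
  apply/existsP; apply: contraNT nAB; rewrite negb_exists => /forallP h.
  by apply/eqP/setP => k; apply/eqP; rewrite -[_ == _]negbK h.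
case: (arg_minnP (fun k : 'I_n => val k) Pm0) => m Pm hm.
have e (k : 'I_n) : (k < m)%N -> (k \in A) = (k \in B).
  by move=> km; apply/eqP; apply: contraLR km => /hm; rewrite -leqNgt.
move: Pm; rewrite /P; case mA: (m \in A); case mB: (m \in B) => // _.
  by apply/orP; left; apply/rlex_ltP; split=> //; exists m; rewrite mA mB; split.
apply/orP; right; apply/rlex_ltP; split=> //; exists m; rewrite mA mB; split=> // k km.
by rewrite e.
Qed.

Definition rlex_upper (S : {set {set 'I_n}}) : Prop :=
  forall A B, A \in S -> rlex_lt A B -> B \in S.

(** Minimise the number of elements of [S] lying below; anything below the minimiser would have
    strictly fewer, by transitivity and irreflexivity. *)
Lemma rlex_min (S : {set {set 'I_n}}) A0 : A0 \in S ->
  exists2 A, A \in S & forall B, B \in S -> ~~ rlex_lt B A.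
Proof.
move=> S0; pose below A := #|[set B in S | rlex_lt B A]|.
case: (arg_minnP below S0) => A AS hA; exists A => // B BS; apply/negP => ltBA.
have := hA B BS; rewrite leqNgt => /negP[]; apply: proper_card.
apply/properP; split.
  by apply/subsetP => C; rewrite !inE => /andP[-> /rlex_lt_trans]; apply.
by exists B; rewrite !inE BS ?rlex_lt_irr.
Qed.

End Rlex.

(** * Initial monomials counted by dimensions of coordinate projections *)

Section Count.
Variables (K : fieldType) (n : nat).
Local Notation E := (ext K n).
Implicit Types (A B C : {set 'I_n}) (S : {set {set 'I_n}}) (W : {vspace E}).

(** The other coordinates are set to zero instead of being dropped, so images and kernels for
    different [S] are subspaces of the same space. *)
Definition restr_fun S (x : E) : E := mkext (fun A => if A \in S then coord x A else 0).

Lemma coord_restr_fun S x A : coord (restr_fun S x) A = if A \in S then coord x A else 0.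
Proof. exact: coordK. Qed.

Lemma restr_fun_linear S : linear (restr_fun S).
Proof.
move=> a x y; apply: extP => A; rewrite coordD coordZ 3!coord_restr_fun coordD coordZ.
by case: ifP; rewrite ?mulr0 ?addr0.
Qed.

HB.instance Definition _ S :=
  GRing.isLinear.Build K E E *:%R (restr_fun S) (restr_fun_linear S).

Definition restr S : 'End(E) := linfun (restr_fun S).

Lemma coord_restr S x A : coord (restr S x) A = if A \in S then coord x A else 0.
Proof. by rewrite lfunE coord_restr_fun. Qed.

Lemma restr_eq0 S (x : E) :
  reflect (forall A, A \in S -> coord x A = 0) (x \in lker (restr S)).
Proof.
rewrite memv_ker; apply: (iffP eqP) => [h A AS|h].
  by have := congr1 (fun y => coord y A) h; rewrite /= coord_restr AS coord0.
by apply: extP => A; rewrite coord_restr coord0; case: ifP => // /h.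
Qed.

Definition coord_fun A (x : E) : K^o := coord x A.

Lemma coord_fun_linear A : linear (coord_fun A).
Proof. by move=> a x y; rewrite /coord_fun coordD coordZ. Qed.

HB.instance Definition _ A :=
  GRing.isLinear.Build K E K^o *:%R (coord_fun A) (coord_fun_linear A).

Definition coordf A : 'Hom(E, K^o) := linfun (coord_fun A).

Lemma coordfE A x : coordf A x = coord x A.
Proof. by rewrite lfunE. Qed.

Lemma initial_monsP W A :
  reflect (exists2 f : E, f \in W & is_initial f A) (A \in initial_mons W).
Proof. by rewrite inE; apply: boolp.asboolP. Qed.

Lemma gradedv_comp W j (x : E) : gradedv W -> x \in W -> ecomp K n j x \in W.
Proof. by move=> gW xW; apply: (subvP (gW j)); rewrite memv_img. Qed.

Lemma dim_Ko_le1 (U : {vspace K^o}) : (\dim U <= 1)%N.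
Proof. by rewrite (leq_trans (dimvS (subvf U))) // dimvf. Qed.

(* Removing the least element [A] of [S] lowers the dimension by one exactly when
   [A] is an initial monomial of [W]. *)
Lemma dim_restr W S (j : int) : gradedv W -> (forall A, A \in S -> #|A|%:Z = j) ->
  rlex_upper S -> \dim (restr S @: W) = #|S :&: initial_mons W|.
Proof.
move=> gW; elim: {S}_.+1 {-2}S (ltnSn #|S|) => // m IHm S; rewrite ltnS => Sm hS uS.
have [->|[A0 A0S]] := set_0Vmem S.
  rewrite set0I cards0; apply/eqP; rewrite dimv_eq0 -subv0.
  apply/subvP => _ /memv_imgP[x _ ->]; rewrite memv0 -memv_ker; apply/restr_eq0 => A.
  by rewrite inE.
have [A AS minA] := rlex_min A0S.
have gtA B : B \in S -> B != A -> rlex_lt A B.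
  move=> BS nBA; have /orP[] // : rlex_lt A B || rlex_lt B A.
    apply: rlex_lt_total; rewrite 1?eq_sym //.
    by have := hS A AS; rewrite -(hS B BS) => -[].
  by move=> /(negP (minA _ BS)).
have cS' : #|S| = #|S :\ A|.+1 by rewrite (cardsD1 A S) AS.
have IH : \dim (restr (S :\ A) @: W) = #|(S :\ A) :&: initial_mons W|.
  apply: IHm => [|B|B C]; first by rewrite -cS'.
    by rewrite !inE => /andP[_ /hS].
  rewrite !inE => /andP[nBA BS] ltBC; rewrite (uS _ _ BS ltBC) andbT.
  by apply/eqP => e; move: ltBC; rewrite e (negPf (minA _ BS)).
(* Rank-nullity three times: by [e4] the third kernel is that of [restr S] on [W], so removing [A]
   lowers the dimension by that of the image of [coordf A], which is at most one. *)
have e1 := limg_ker_dim (restr S) W.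
have e2 := limg_ker_dim (restr (S :\ A)) W.
have e3 := limg_ker_dim (coordf A) (W :&: lker (restr (S :\ A)))%VS.
have e4 : (W :&: lker (restr (S :\ A)) :&: lker (coordf A) = W :&: lker (restr S))%VS.
  rewrite -capvA; congr (_ :&: _)%VS; apply/vspaceP => x; rewrite memv_cap.
  apply/andP/restr_eq0 => [[/restr_eq0 h /[!memv_ker] /eqP] /[!coordfE] h0 B BS|h].
    by have [->//|nBA] := eqVneq B A; apply: h; rewrite !inE nBA.
  split; last by rewrite memv_ker coordfE h.
  by apply/restr_eq0 => B; rewrite !inE => /andP[_ /h].
suff e5 : \dim (coordf A @: (W :&: lker (restr (S :\ A)))) = (A \in initial_mons W).
  rewrite e4 e5 in e3.
  have -> : #|S :&: initial_mons W| =
      ((A \in initial_mons W) + #|(S :\ A) :&: initial_mons W|)%N.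
    by rewrite (cardsD1 A) !inE AS /= setIDAC.
  by rewrite -IH; apply/eqP; rewrite -(eqn_add2l (\dim (W :&: lker (restr S)))) addnA e3 e2 e1.
apply/eqP; rewrite eqn_leq; case: (boolP (A \in initial_mons W)) => hA.
  rewrite dim_Ko_le1 lt0n dimv_eq0; case/initial_monsP: hA => f fW [_ fA0 hf].
  apply/eqP => h0; have : coordf A f \in (coordf A @: (W :&: lker (restr (S :\ A))))%VS.
    rewrite memv_img // memv_cap fW; apply/restr_eq0 => B; rewrite !inE => /andP[nBA BS].
    by apply/eqP; apply: contraNT (minA B BS) => /hf; apply.
  by rewrite h0 memv0 coordfE (negPf fA0).
rewrite andbT leqn0 dimv_eq0 -subv0; apply/subvP => _ /memv_imgP[f + ->].
rewrite memv_cap memv0 coordfE => /andP[fW /restr_eq0 h].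
(* The component of [f] in degree [j] has initial monomial [A]: a larger monomial of that degree
   lies in the upper set [S], where [f] vanishes outside [A]. *)
apply: contraNT hA => fA0; apply/initial_monsP; exists (ecomp K n j f).
  exact: gradedv_comp.
split; first by exists j; rewrite memv_img ?memvf.
  by rewrite coord_ecomp hS // eqxx.
move=> B; rewrite coord_ecomp; have [cB fB0 nBA|_ /eqP//] := eqVneq #|B|%:Z j.
have cBA : #|B| = #|A| by have := hS A AS; rewrite -cB => -[].
have /orP[//|ltAB] := rlex_lt_total cBA nBA.
have BS := uS _ _ AS ltAB.
by move: fB0; rewrite h ?eqxx // !inE nBA.
Qed.

End Count.

(** * Substitution of linear forms as a graded algebra endomorphism *)

Section Substitution.
Variables (K : fieldType) (n : nat).
Local Notation E := (ext K n).
Implicit Types (A B C : {set 'I_n}) (x y : E) (g h : 'M[K]_n).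

Lemma ext_sum_mon x : x = \sum_(A : {set 'I_n}) coord x A *: mon A.
Proof.
apply: extP => B; rewrite coord_sum (bigD1 B) //= coordZ coord_mon eqxx mulr1.
rewrite big1 ?addr0 // => A AB.
by rewrite coordZ coord_mon eq_sym (negPf AB) mulr0.
Qed.

Lemma ext_ind (P : E -> Prop) : (forall a x y, P x -> P y -> P (a *: x + y)) ->
  P 0 -> (forall A, P (mon A)) -> forall x, P x.
Proof.
move=> Plin P0 Pmon x; rewrite [x]ext_sum_mon; elim/big_rec: _ => // A y _ Py.
exact: Plin.
Qed.

Lemma E1_anticomm (v w : E1 K n) : vsval v * vsval w = - (vsval w * vsval v).
Proof. by rewrite (ecomp_sign (subvsP v) (subvsP w)) expr1 scaleN1r. Qed.

Lemma E1_mul_prod (v : E1 K n) (w : 'I_n -> E1 K n) (P : pred 'I_n) s :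
  vsval v * \prod_(k <- s | P k) vsval (w k) =
  (-1) ^+ count P s *: (\prod_(k <- s | P k) vsval (w k) * vsval v).
Proof.
elim: s => [|k s IHs] /=; first by rewrite big_nil mulr1 mul1r expr0 scale1r.
rewrite big_cons; case: (P k) => //=.
rewrite mulrA E1_anticomm mulNr -[in LHS]mulrA IHs -scalerAr mulrA.
by rewrite add1n exprS mulN1r scaleNr.
Qed.

(** Isolates the factor of index [i] in an ordered product, between the smaller and the larger
    indices. *)
Lemma enum_ord_split (i : 'I_n) : exists s1 s2,
  [/\ index_enum 'I_n = s1 ++ i :: s2, forall k, k \in s1 -> (k < i)%N
    & forall k, k \in s2 -> (i < k)%N].
Proof.
have so : pairwise (fun a b : 'I_n => a < b)%N (index_enum 'I_n).
  have := iota_ltn_sorted 0 n.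
  rewrite -val_enum_ord enumT (sorted_pairwise ltn_trans) pairwise_map.
  by rewrite /index_enum unlock.
case/path.splitPr: (mem_index_enum i) so => s1 s2; rewrite pairwise_cat pairwise_cons.
move=> /and3P[/allrelP h1 _ /andP[/allP h2 _]]; exists s1, s2; split=> // k ks1.
by apply: h1 => //; rewrite mem_head.
Qed.

Lemma big_enum_seq (I : finType) (R : Type) (idx : R) (op : R -> R -> R) (A : {set I}) F :
  \big[op/idx]_(i <- enum A) F i = \big[op/idx]_(i in A) F i.
Proof. by rewrite -[RHS]big_filter /index_enum unlock. Qed.

Lemma eq_bigl_seq (I : eqType) (R : Type) (idx : R) (op : R -> R -> R) (s : seq I)
    (P Q : pred I) F : {in s, P =1 Q} ->
  \big[op/idx]_(i <- s | P i) F i = \big[op/idx]_(i <- s | Q i) F i.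
Proof.
move=> ePQ; rewrite -[LHS]big_filter -[RHS]big_filter.
by rewrite (eq_in_filter ePQ).
Qed.

(** Moving [w i] into its place past the factors of smaller index gives one sign for each, hence
    [esign]; if [i] is already present, a square of a linear form appears and vanishes. *)
Lemma E1_mul_prod_set (w : 'I_n -> E1 K n) (i : 'I_n) A :
  vsval (w i) * \prod_(k in A) vsval (w k) =
  if i \in A then 0 else esign K [set i] A *: \prod_(k in i |: A) vsval (w k).
Proof.
have [s1 [s2 [e lt1 lt2]]] := enum_ord_split i.
rewrite e !big_cat !big_cons /= mulrA E1_mul_prod -scalerAl -mulrA.
rewrite !inE eqxx /=; case: ifP => [iA|niA].
  by rewrite [vsval (w i) * (_ * _)]mulrA E1_sqr0 mul0r mulr0 scaler0.
have e1 : \prod_(k <- s1 | k \in i |: A) vsval (w k) = \prod_(k <- s1 | k \in A) vsval (w k).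
  apply: eq_bigl_seq => k ks; rewrite !inE.
  by have := lt1 k ks; case: eqP => // ->; rewrite ltnn.
have e2 : \prod_(k <- s2 | k \in i |: A) vsval (w k) = \prod_(k <- s2 | k \in A) vsval (w k).
  apply: eq_bigl_seq => k ks; rewrite !inE.
  by have := lt2 k ks; case: eqP => // ->; rewrite ltnn.
rewrite e1 e2 /esign /inversions big_set1 e big_cat big_cons /= niA.
rewrite [X in (_ + X)%N]big1_seq ?addn0 => [|k /andP[_ ks]]; last first.
  by rewrite ltnNge ltnW // lt2.
congr (_ ^+ _ *: _); rewrite -sum1_count [LHS]big_seq_cond [RHS]big_seq_cond.
by apply: eq_bigr => k /andP[/lt1 ->].
Qed.

Variable g : 'M[K]_n.

Lemma subst_mon A : subst g (mon A) = \prod_(i in A) vsval (change_vars g i).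
Proof.
rewrite lfunE /= /subst_fun (bigD1 A) //= coord_mon eqxx scale1r big_enum_seq.
by rewrite [X in _ + X]big1 ?addr0 // => B BA; rewrite coord_mon (negPf BA) scale0r.
Qed.

Lemma subst_one : subst g 1 = 1.
Proof. by rewrite emul1E subst_mon big_set0. Qed.

(** On monomials both sides obey the same sign rule, given by [mon_mul] before the substitution and
    by [E1_mul_prod_set] after it. *)
Lemma subst_mul_evar i x :
  subst g (mon [set i] * x) = vsval (change_vars g i) * subst g x.
Proof.
elim/ext_ind: x => [a x y IHx IHy||A].
- by rewrite mulrDr -scalerAr !linearP /= IHx IHy mulrDr -scalerAr.
- by rewrite !(mulr0, linear0).
rewrite mon_mul disjoints1 subst_mon E1_mul_prod_set if_neg.
by case: ifP => _; rewrite ?linear0 // linearZ /= subst_mon.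
Qed.

Lemma subst_evar i : subst g (mon [set i]) = vsval (change_vars g i).
Proof. by rewrite -[mon _]mulr1 subst_mul_evar subst_one mulr1. Qed.

(** After reduction to a monomial [x], [mon_prod] allows its variables to be pulled out one at a
    time. *)
Lemma substM x y : subst g (x * y) = subst g x * subst g y.
Proof.
elim/ext_ind: x => [a x x' IHx IHx'||A].
- by rewrite mulrDl -scalerAl !linearP /= IHx IHx' mulrDl -scalerAl.
- by rewrite !(mul0r, linear0).
rewrite mon_prod; elim: (enum A) => [|i s IHs].
  by rewrite big_nil subst_one !mul1r.
by rewrite big_cons -mulrA !subst_mul_evar IHs mulrA.
Qed.

Lemma prod_E1_deg (w : 'I_n -> E1 K n) s :
  \prod_(k <- s) vsval (w k) \in limg (ecomp K n (size s)).
Proof.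
elim: s => [|k s IHs] /=.
  by rewrite big_nil emul1E; have := mon_mem K (@set0 'I_n); rewrite cards0.
by rewrite big_cons -add1n PoszD ecomp_mul // subvsP.
Qed.

Lemma subst_ecomp j x : subst g (ecomp K n j x) = ecomp K n j (subst g x).
Proof.
elim/ext_ind: x => [a x y IHx IHy||A].
- by rewrite !linearP /= IHx IHy.
- by rewrite !linear0.
have /(grading_memP _ _ (ecomp_grading K n)) e := mon_mem K A.
have : subst g (mon A) \in limg (ecomp K n #|A|).
  by rewrite subst_mon -big_enum_seq cardE prod_E1_deg.
move=> /(grading_memP _ _ (ecomp_grading K n)) e'.
by rewrite -[in LHS]e -[in RHS]e' !ecomp_ecomp; case: ifP => _; rewrite ?linear0 // e e'.
Qed.

Lemma limg_subst_deg j : (subst g @: limg (ecomp K n j) <= limg (ecomp K n j))%VS.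
Proof.
apply/subvP => _ /memv_imgP[_ /memv_imgP[x _ ->] ->].
by rewrite subst_ecomp memv_img ?memvf.
Qed.
End Substitution.

(** * Composition and inversion of substitutions *)

Section SubstitutionGroup.
Variables (K : fieldType) (n : nat).
Local Notation E := (ext K n).
Implicit Types (g h : 'M[K]_n) (J : {vspace E}).

(** By multiplicativity it is enough to compare variables. Their images are the columns of the
    matrix, so the order of composition is that of the matrix product. *)
Lemma subst_comp g h x : subst g (subst h x) = subst (g *m h) x.
Proof.
elim/ext_ind: x => [a x y IHx IHy||A].
- by rewrite !linearP /= IHx IHy.
- by rewrite !linear0.
rewrite mon_prod; elim: (enum A) => [|i s IHs]; first by rewrite big_nil !subst_one.
rewrite big_cons !substM IHs; congr (_ * _); rewrite !subst_evar /change_vars.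
rewrite !linear_sum /=.
under eq_bigr => k _ do rewrite !linearZ /= subst_evar /change_vars linear_sum scaler_sumr.
rewrite exchange_big /=; apply: eq_bigr => k _.
by rewrite mxE scaler_suml; apply: eq_bigr => l _; rewrite scalerA mulrC.
Qed.

Lemma subst_inj g : g \in unitmx -> (lker (subst g) == 0)%VS.
Proof.
move=> gU; apply/lker0P => x y /(congr1 (subst (invmx g))).
by rewrite !subst_comp mulVmx // !subst1.
Qed.

Lemma limg_subst g : g \in unitmx -> limg (subst g) = fullv.
Proof.
move=> gU; apply/eqP; rewrite eqEsubv subvf; apply/subvP => x _.
by rewrite -[x]subst1 -(mulmxV gU) -subst_comp memv_img ?memvf.
Qed.

Lemma gradedv_subst g J : gradedv J -> gradedv (subst g @: J)%VS.
Proof.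
move=> gJ j; apply/subvP => _ /memv_imgP[_ /memv_imgP[x xJ ->] ->].
by rewrite -subst_ecomp memv_img // gradedv_comp.
Qed.
End SubstitutionGroup.

(** * Hilbert functions of sums with ideals of linear forms *)

Section VariableQuotients.
Variables (K : fieldType) (n : nat).
Local Notation E := (ext K n).
Implicit Types (J I : {vspace E}) (g : 'M[K]_n).

(** The ideal generated by the first [i] forms; left multiples suffice by sign commutation. The
    index is a [nat], so that [i = n] is allowed. *)
Definition var_span (v : 'I_n -> E1 K n) (i : nat) : {vspace E} :=
  (\sum_(k < n | (k < i)%N) limg (amull (vsval (v k))))%VS.

Lemma gradedv_var_span v i : gradedv (var_span v i).
Proof.
move=> l; rewrite /var_span limg_sum; apply/subv_sumP => k ki.
apply: subv_trans (sumv_sup k _ (subvv _)) => //.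
apply/subvP => _ /memv_imgP[_ /memv_imgP[x _ ->] ->]; rewrite amullE.
have := @hcomp_lact_E1 K n (extM K n) (v k) l x; rewrite /= !amullE => ->.
by rewrite -amullE memv_img ?memvf.
Qed.

Definition hilb J (j : int) : nat := \dim (J :&: limg (ecomp K n j))%VS.

Lemma limg_subst_deg_eq g j : g \in unitmx ->
  (subst g @: limg (ecomp K n j) = limg (ecomp K n j))%VS.
Proof.
move=> gU; apply/eqP; rewrite eqEdim limg_subst_deg /= (limg_dim_eq (f := subst g)) //.
by rewrite (eqP (subst_inj gU)) capv0.
Qed.

Lemma limg_cap_inj (V W : vectType K) (f : 'Hom(V, W)) (X Y : {vspace V}) :
  lker f == 0%VS -> (f @: (X :&: Y) = f @: X :&: f @: Y)%VS.
Proof.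
move=> /lker0P fi; apply/eqP; rewrite eqEsubv limg_cap /=.
apply/subvP => y; rewrite memv_cap => /andP[/memv_imgP[x xX ->] /memv_imgP[z zY /fi e]].
by rewrite memv_img // memv_cap xX e.
Qed.

(** The automorphism [subst g] maps the ideal of the first [i] variables onto that of the new forms
    and preserves each degree. *)
Lemma hilb_subst g J i j : g \in unitmx ->
  hilb (subst g @: J + var_span (change_vars g) i) j = hilb (J + var_span evar i) j.
Proof.
move=> gU; rewrite /hilb.
have -> : var_span (change_vars g) i = (subst g @: var_span evar i)%VS.
  rewrite /var_span limg_sum; apply: eq_bigr => k _.
  apply/vspaceP => x; apply/memv_imgP/memv_imgP => [[y _ ->]|[_ /memv_imgP[y _ ->] ->]].
    have /memv_imgP[z _ ->] : y \in limg (subst g) by rewrite limg_subst ?memvf.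
    exists (mon [set k] * z); rewrite ?amullE ?subst_mul_evar //.
    by rewrite -[mon _ * z]amullE memv_img ?memvf.
  by exists (subst g y); rewrite ?memvf // !amullE subst_mul_evar.
rewrite -limgD -{1}(limg_subst_deg_eq j gU) -limg_cap_inj ?subst_inj //.
by rewrite (limg_dim_eq (f := subst g)) // (eqP (subst_inj gU)) capv0.
Qed.

Lemma graded_restr J (S : {set {set 'I_n}}) (j : int) : gradedv J ->
  (forall A, A \in S -> #|A|%:Z = j) ->
  (restr K S @: J = restr K S @: (J :&: limg (ecomp K n j)))%VS.
Proof.
move=> gJ hS; apply/eqP; rewrite eqEsubv; apply/andP; split; last by rewrite limgS ?capvSl.
apply/subvP => _ /memv_imgP[x xJ ->].
have -> : restr K S x = restr K S (ecomp K n j x).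
  apply: extP => A; rewrite !coord_restr; case: ifP => // /hS.
  by rewrite coord_ecomp => ->; rewrite eqxx.
by rewrite memv_img // memv_cap gradedv_comp // memv_img ?memvf.
Qed.

Definition avoid_vars (i : nat) (j : int) : {set {set 'I_n}} :=
  [set A : {set 'I_n} | (#|A|%:Z == j) && [forall (k : 'I_n | k \in A), (i <= k)%N]].

Lemma avoid_varsP i j (A : {set 'I_n}) :
  reflect (#|A|%:Z = j /\ forall k : 'I_n, k \in A -> (i <= k)%N) (A \in avoid_vars i j).
Proof.
rewrite inE; apply: (iffP andP) => [[/eqP cA /forall_inP]|[cA hA]] //.
by split; [apply/eqP | apply/forall_inP].
Qed.

(** The first index [m] of difference lies in [A], hence is at least [i]. Elements of [B] below [m]
    belong to [A], and the others are at least [m]. *)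
Lemma avoid_vars_upper i j : rlex_upper (avoid_vars i j).
Proof.
move=> A B /avoid_varsP[cA hA] /rlex_ltP[cAB [m [mA mB hm]]].
apply/avoid_varsP; split; first by rewrite -cAB.
move=> k kB; case: (ltnP k m) => [km|mk]; first by rewrite hA // hm.
exact: leq_trans (hA _ mA) mk.
Qed.

(** Multiples of a variable have coordinates only on sets containing it; conversely a monomial
    containing one of the first [i] variables is, up to sign, a multiple of it. *)
Lemma var_span_deg i j :
  (var_span evar i :&: limg (ecomp K n j) =
   limg (ecomp K n j) :&: lker (restr K (avoid_vars i j)))%VS.
Proof.
apply/vspaceP => x; rewrite !memv_cap andbC; apply: andb_id2l => xj.
apply/idP/restr_eq0 => [|h].
  rewrite /var_span => /memv_sumP[f hf ->] A /avoid_varsP[cA hA].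
  rewrite coord_sum big1 // => k ki; have /memv_imgP[y _ ->] := hf k ki.
  rewrite amullE coordM big1 // => B sBA; rewrite coord_mon; case: eqP => [eB|]; last first.
    by rewrite mulr0 mul0r.
  have /hA : k \in A by apply: (subsetP sBA); rewrite eB inE.
  by rewrite leqNgt ki.
rewrite [x]ext_sum_mon memv_suml // => A _.
have [cA|nA] := eqVneq #|A|%:Z j; last first.
  by move/ecomp_mem: xj => ->; rewrite ?scale0r ?mem0v.
have [/h ->|] := boolP (A \in avoid_vars i j); first by rewrite scale0r mem0v.
rewrite inE cA eqxx /= => /forall_inPn[k kA]; rewrite -ltnNge => ki.
rewrite memvZ //.
have -> : mon A = (esign K [set k] (A :\ k))^-1 *: (mon [set k] * mon (A :\ k)).
  rewrite mon_mul disjoints1 !inE eqxx /= setD1K // scalerA mulVf ?scale1r //.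
  by rewrite /esign signr_eq0.
rewrite memvZ // -amullE.
by apply: (subvP (sumv_sup k _ (subvv _))); rewrite ?memv_img ?memvf.
Qed.

(** Rank-nullity for [restr] on the part of degree [j]: the kernel is the contribution of the
    variables, and the image comes from [I] alone. *)
Lemma hilb_var_span I i j : gradedv I ->
  (hilb (I + var_span evar i) j =
   \dim (var_span evar i :&: limg (ecomp K n j)) + \dim (restr K (avoid_vars i j) @: I))%N.
Proof.
move=> gI; set S := avoid_vars i j.
have hS A : A \in S -> #|A|%:Z = j by move=> /avoid_varsP[].
have gP : gradedv (var_span evar i) by apply: gradedv_var_span.
have gIP : gradedv (I + var_span evar i)%VS.
  by move=> l; rewrite limgD addvS.
rewrite /hilb -[LHS](limg_ker_dim (restr K S)); congr (_ + _)%N.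
  rewrite -capvA -var_span_deg capvA; congr (\dim (_ :&: _))%VS.
  exact/capv_idPr/addvSr.
rewrite -graded_restr // limgD; congr (\dim _); apply/addv_idPl.
rewrite (graded_restr gP hS) var_span_deg.
apply/subvP => _ /memv_imgP[x /[!memv_cap] /andP[_ /[!memv_ker]/eqP->] ->].
exact: mem0v.
Qed.

End VariableQuotients.

(** * Hilbert functions of an ideal and of its initial ideal *)

Section InitialIdeal.
Variables (K : fieldType) (n : nat).
Local Notation E := (ext K n).
Implicit Types (A B C : {set 'I_n}) (I : {vspace E}).

Lemma coord_mon_mul D (f : E) B :
  coord (mon D * f) B = if D \subset B then esign K D (B :\: D) * coord f (B :\: D) else 0.
Proof.
rewrite coordM; case: ifP => sDB; last first.
  rewrite big1 // => A sAB; rewrite coord_mon; case: eqP => [e|]; last by rewrite mulr0 mul0r.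
  by rewrite -e sAB in sDB.
rewrite (bigD1 D) //= coord_mon eqxx mulr1 big1 ?addr0 // => A /andP[_ /negPf nAD].
by rewrite coord_mon nAD mulr0 mul0r.
Qed.

(** Multiply by [mon (C :\: A)]. The surviving monomials come from sets disjoint from [C :\: A], and
    adjoining it to two such sets leaves their symmetric difference, hence their order,
    unchanged. *)
Lemma initial_mons_up I A C : (forall a x : E, x \in I -> a * x \in I) ->
  A \in initial_mons I -> A \subset C -> C \in initial_mons I.
Proof.
move=> idI /initial_monsP[f fI [[j fj] fA hf]] sAC; apply/initial_monsP.
have eA : C :\: (C :\: A) = A by rewrite setDDr setDv set0U; apply/setIidPr.
exists (mon (C :\: A) * f); first exact: idI.
split.
- by exists (#|C :\: A|%:Z + j); rewrite ecomp_mul ?mon_mem.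
- by rewrite coord_mon_mul subsetDl eA mulf_neq0 // /esign signr_eq0.
move=> B; rewrite coord_mon_mul; case: ifP => [sDB|]; last by rewrite eqxx.
rewrite mulf_eq0 negb_or => /andP[_ fB] nBC.
have nBA : B :\: (C :\: A) != A.
  apply: contraNneq nBC => eBA; rewrite -(setUDK sDB) eBA -[X in X :|: A]/(C :\: A).
  by rewrite setUC setUDK.
have /rlex_ltP[cBA [m [mB mA hm]]] := hf _ fB nBA.
apply/rlex_ltP; split.
  rewrite -(setUDK sDB) -[in RHS](setUDK sAC) setUC !cardsU cBA.
  by rewrite !(disjoint_setI0 _) ?cards0 ?disjointD // disjoint_sym disjointD.
exists m; move: mB; rewrite !inE (negPf mA) /= => /andP[nmC mB].
split=> // k km; have := hm k km; rewrite !inE.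
have := subsetP sAC k; have := subsetP sDB k; rewrite !inE.
by case: (k \in A) (k \in B) (k \in C) => [] [] [] //= h1 h2 h3;
  first [by have := h1 isT | by have := h2 isT].
Qed.

(** The span of the monomials indexed by [T], written as a kernel so that membership is a condition
    on coordinates. *)
Definition mon_support (T : {set {set 'I_n}}) : {vspace E} := lker (restr K (~: T)).

Lemma mon_supportP (T : {set {set 'I_n}}) x :
  reflect (forall A, coord x A != 0 -> A \in T) (x \in mon_support T).
Proof.
apply: (iffP (restr_eq0 _ _)) => h A; last by rewrite inE; apply: contraNeq => /h.
by apply: contraNT => nAT; rewrite h // inE.
Qed.

Lemma mon_support_ideal (T : {set {set 'I_n}}) (u x w : E) :
  (forall A C, A \in T -> A \subset C -> C \in T) ->
  x \in mon_support T -> u * x * w \in mon_support T.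
Proof.
move=> upT /mon_supportP hx; have hux : u * x \in mon_support T.
  apply/mon_supportP => C; apply: contraNT => nCT; rewrite coordM big1 // => A sAC.
  apply/eqP; apply: contraNT nCT; rewrite mulf_eq0 negb_or => /andP[_ /hx hT].
  by apply: upT hT _; rewrite subsetDl.
apply/mon_supportP => C; apply: contraNT => nCT; rewrite coordM big1 // => A sAC.
apply/eqP; apply: contraNT nCT; rewrite !mulf_eq0 !negb_or => /andP[/andP[_ hA] _].
by move/mon_supportP: hux => /(_ _ hA) /upT; apply.
Qed.

(** The initial monomials are closed under supersets, so their span is already an ideal and contains
    no element with a coordinate on another monomial. *)
Lemma initial_mons_ideal I : (forall a x : E, x \in I -> a * x \in I) ->
  initial_mons (initial_ideal I) = initial_mons I.
Proof.
move=> idI; apply/setP => A; apply/idP/idP.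
  case/initial_monsP=> f + [_ fA _]; suff /subvP h :
      (initial_ideal I <= mon_support (initial_mons I))%VS.
    by move/h/mon_supportP => /(_ A fA).
  have up B C : B \in initial_mons I -> B \subset C -> C \in initial_mons I.
    exact: initial_mons_up.
  have XZ : (<<[seq mon B | B in initial_mons I]>> <= mon_support (initial_mons I))%VS.
    apply/span_subvP => _ /imageP[B hB ->]; apply/mon_supportP => C.
    by rewrite coord_mon; have [->|_] := eqVneq C B; rewrite ?eqxx.
  have lZ : (fullv * <<[seq mon B | B in initial_mons I]>> <=
             mon_support (initial_mons I))%VS.
    apply/prodvP => u x _ /(subvP XZ) xZ.
    by rewrite -[u * x]mulr1 mon_support_ideal.
  apply/prodvP => y w /(subvP lZ) yZ _.
  by rewrite -[y]mul1r mon_support_ideal.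
move=> hA; apply/initial_monsP; exists (mon A).
  rewrite -[mon A]mulr1 -[mon A]mul1r !memv_mul ?memvf // memv_span //.
  by apply: map_f; rewrite mem_enum.
split; first by exists #|A|%:Z; apply: mon_mem.
  by rewrite coord_mon eqxx oner_eq0.
by move=> B; rewrite coord_mon => + /negPf nBA; rewrite nBA eqxx.
Qed.

Lemma gsubmod_gradedv (J : gideal K n) : gradedv (J : {vspace E}).
Proof. by case: (gsubP J). Qed.

Lemma gsubmod_mull (J : gideal K n) (a x : E) :
  x \in (J : {vspace E}) -> a * x \in (J : {vspace E}).
Proof.
case: (gsubP J) => lJ _ _ xJ; apply: (subvP (lJ a)).
by have := memv_img (amull a) xJ; rewrite amullE.
Qed.

Lemma initial_ideal_gradedv I : gradedv (initial_ideal I).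
Proof. by case: (initial_idealP I). Qed.

(** By [dim_restr] both sides count the same initial monomials in the upper set [avoid_vars]. *)
Lemma hilb_initial_ideal I i j : gradedv I -> (forall a x : E, x \in I -> a * x \in I) ->
  hilb (initial_ideal I + var_span evar i) j = hilb (I + var_span evar i) j.
Proof.
move=> gI idI; have hS A : A \in avoid_vars n i j -> #|A|%:Z = j by move=> /avoid_varsP[].
rewrite !hilb_var_span //; last exact: initial_ideal_gradedv.
rewrite !(dim_restr _ hS) ?initial_mons_ideal //; try exact: avoid_vars_upper.
exact: initial_ideal_gradedv.
Qed.

End InitialIdeal.

(** * Annihilator numbers in terms of Hilbert functions *)

Section Homology.
Variables (K : fieldType).

Lemma dim_subvsf (V : vectType K) (U : {vspace V}) : \dim {: subvs_of U} = \dim U.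
Proof. by rewrite dimvf. Qed.

Lemma dim_quotv (V : vectType K) (N : {vspace V}) :
  \dim {: quotv N} = (\dim {: V} - \dim N)%N.
Proof. by rewrite dim_subvsf dimv_compl dimvf. Qed.

Lemma dim_quot_sub (V : vectType K) (Z B : {vspace V}) : (B <= Z)%VS ->
  \dim {: quotv (linfun (vsval : subvs_of Z -> V) @^-1: B)%VS} = (\dim Z - \dim B)%N.
Proof.
move=> sBZ; rewrite dim_quotv dim_subvsf; congr (_ - _)%N.
set f := linfun _; have fE x : f x = vsval x by rewrite lfunE.
have fi : lker f == 0%VS.
  by apply/lker0P => x y; rewrite !fE => /val_inj.
rewrite -(limg_dim_eq (f := f)); last by rewrite (eqP fi) capv0.
congr (\dim _); apply/vspaceP => x; apply/memv_imgP/idP => [[y + ->]|xB].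
  by rewrite -memv_preim.
have xZ := subvP sBZ _ xB; exists (Subvs xZ); last by rewrite fE.
by rewrite -memv_preim fE.
Qed.

(** Rank-nullity for multiplication by [v] out of degree [j]: the dimension of the cycles is the
    first difference. *)
Lemma dim_homology n (M : emod K n) (v : E1 K n) (j : int) :
  \dim {: homology M v j} =
  (\dim (hpart M j) - \dim (boundaries M v (j + 1)) - \dim (boundaries M v j))%N.
Proof.
rewrite dim_quot_sub; last exact: boundaries_cycles.
congr (_ - _)%N; rewrite /boundaries addrK.
by rewrite -[\dim (hpart M j)](limg_ker_dim (ract (vsval v))) addnK.
Qed.

Variable n : nat.
Local Notation E := (ext K n).
Variables (J : gideal K n) (v : 'I_n -> E1 K n).
Local Notation Q i := ((J : {vspace E}) + var_span v i)%VS.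
Local Notation M i := (quotM (Mideal_sub (quotM J) v i)).

Definition quot_map (i : 'I_n) : 'Hom(E, M i) :=
  (qproj (Mideal (quotM J) v i) \o qproj (J : {vspace E}))%VF.

Lemma quot_mapE i x :
  quot_map i x = qproj (Mideal (quotM J) v i) (qproj (J : {vspace E}) x).
Proof. by rewrite /quot_map comp_lfunE. Qed.

Lemma quotM_ract i a x : ract a (quot_map i x) = quot_map i (x * a).
Proof.
have [_ l1 _] := gsubP (Mideal_sub (quotM J) v i); have [_ l2 _] := gsubP J.
rewrite !quot_mapE (qmapE _ (l1 a)) /=; congr (qproj _ _).
by rewrite (qmapE _ (l2 a)) amulrE.
Qed.

Lemma quotM_hcomp i j x : hcomp j (quot_map i x) = quot_map i (ecomp K n j x).
Proof.
have [_ _ l1] := gsubP (Mideal_sub (quotM J) v i); have [_ _ l2] := gsubP J.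
rewrite !quot_mapE (qmapE _ (l1 j)) /=; congr (qproj _ _).
by rewrite (qmapE _ (l2 j)).
Qed.

Lemma quot_map_surj i y : exists x, y = quot_map i x.
Proof.
have [z ->] := qproj_surj y; have [x ->] := qproj_surj z.
by exists x; rewrite quot_mapE.
Qed.

(** Identifies the iterated quotient defining the annihilator numbers with [E] modulo [Q i]. *)
Lemma lker_quot_map i : lker (quot_map i) = Q i.
Proof.
apply/vspaceP => x; rewrite memv_ker quot_mapE qproj_eq0.
apply/idP/idP.
  move=> /memv_sumP[f hf e].
  have /fin_all_exists [y hy] : forall k : 'I_n, exists y,
      (k < i)%N -> f k = qproj (J : {vspace E}) (vsval (v k) * y).
    move=> k; case: (boolP (k < i)%N) => [ki|_]; last by exists 0.
    have /memv_imgP[z _ ->] := hf k ki; have [y ->] := qproj_surj z; exists y => _.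
    by have [l2 _ _] := gsubP J; rewrite (qmapE _ (l2 _)) amullE.
  (* The subtracted combination of the [v k] has the same class as [x] modulo [J], so the difference
     lies in [J]. *)
  rewrite -[x](subrK (\sum_(k < n | (k < i)%N) vsval (v k) * y k)); apply: memv_add.
    rewrite -qproj_eq0 linearB /= e linear_sum /= subr_eq0; apply/eqP.
    by apply: eq_bigr => k /hy.
  by apply: memv_sumr => k ki; rewrite -amullE memv_img ?memvf.
case/memv_addP => a aJ [b /memv_sumP[f hf ->] ->].
have /eqP a0 : qproj (J : {vspace E}) a == 0 by rewrite qproj_eq0.
rewrite linearD /= a0 add0r linear_sum /=.
apply: memv_sumr => k ki; have /memv_imgP[y _ ->] := hf k ki.
have [l2 _ _] := gsubP J; rewrite amullE.
by have := qmapE y (l2 (vsval (v k))); rewrite amullE => <-; rewrite memv_img ?memvf.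
Qed.

Lemma gradedv_Q (i : nat) : gradedv (Q i).
Proof. by move=> l; rewrite limgD addvS ?gsubmod_gradedv ?gradedv_var_span. Qed.

Lemma hpart_quotM i j : hpart (M i) j = (quot_map i @: limg (ecomp K n j))%VS.
Proof.
apply/vspaceP => y; apply/memv_imgP/memv_imgP => [[z _ ->]|[_ /memv_imgP[x _ ->] ->]].
  have [x ->] := quot_map_surj z; exists (ecomp K n j x); rewrite ?memv_img ?memvf //.
  by rewrite quotM_hcomp.
by exists (quot_map i x); rewrite ?memvf ?quotM_hcomp.
Qed.

(** [Q i.+1] is the sum of [Q i] and the multiples of [v i], and [Q i] vanishes in the quotient. *)
Lemma boundaries_quotM (i : 'I_n) j :
  boundaries (M i) (v i) j = (quot_map i @: (Q i.+1 :&: limg (ecomp K n j)))%VS.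
Proof.
have gE := ecomp_grading K n.
have eQ : Q i.+1 = (Q i + limg (amull (vsval (v i))))%VS.
  rewrite -addvA; congr (_ + _)%VS; rewrite /var_span addvC (bigD1 i) //=; congr (_ + _)%VS.
  by apply: eq_bigl => k; rewrite ltnS andbC ltn_neqAle.
rewrite /boundaries hpart_quotM; apply/vspaceP => y; apply/memv_imgP/memv_imgP.
  case=> _ /memv_imgP[_ /memv_imgP[x _ ->] ->] ->; set a := ecomp K n (j - 1) x.
  exists (a * vsval (v i)); last by rewrite quotM_ract.
  have aj : a \in limg (ecomp K n (j - 1)) by rewrite memv_img ?memvf.
  have := ecomp_mul aj (subvsP (v i)); rewrite subrK memv_cap => ->; rewrite andbT eQ.
  apply: (subvP (addvSr _ _)); rewrite (ecomp_sign aj (subvsP (v i))) memvZ //.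
  by rewrite -amullE memv_img ?memvf.
case=> x; rewrite memv_cap eQ => /andP[/memv_addP[q qQ [_ /memv_imgP[b _ ->] ->]]].
(* Only the component of [b] of degree [j - 1] contributes in degree [j]. *)
move=> /(grading_memP _ _ gE) <- ->; set a := ecomp K n (j - 1) b.
have aj : a \in limg (ecomp K n (j - 1)) by rewrite memv_img ?memvf.
have /eqP q0 : quot_map i (ecomp K n j q) == 0.
  by rewrite -memv_ker lker_quot_map gradedv_comp //; apply: gradedv_Q.
have eb : ecomp K n j (vsval (v i) * b) = vsval (v i) * a.
  by have := @hcomp_lact_E1 K n (extM K n) (v i) j b; rewrite /= !amullE.
rewrite amullE (linearD (ecomp K n j)) (linearD (quot_map i)) /= q0 add0r eb.
(* The differential multiplies on the right, so the left multiple is turned around at the cost of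
   the sign [s]. *)
have := ecomp_sign (subvsP (v i)) aj; set s := _ ^+ _ => ->.
exists (quot_map i (s *: a)); first by rewrite memv_img // memvZ.
by rewrite quotM_ract -scalerAl.
Qed.

Lemma dim_quot_map i (W : {vspace E}) :
  \dim (quot_map i @: W) = (\dim W - \dim (Q i :&: W))%N.
Proof. by rewrite -[\dim W](limg_ker_dim (quot_map i)) lker_quot_map capvC addKn. Qed.

(** The right side depends on [J] and [v] only through [hilb], so equal Hilbert functions give equal
    annihilator numbers. *)
Lemma annihilator_number_hilb (i : 'I_n) j :
  annihilator_number v (quotM J) i j =
  (\dim (limg (ecomp K n j)) - hilb (Q i) j
   - (hilb (Q i.+1) (j + 1) - hilb (Q i) (j + 1))
   - (hilb (Q i.+1) j - hilb (Q i) j))%N.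
Proof.
rewrite /annihilator_number dim_homology hpart_quotM !boundaries_quotM !dim_quot_map.
have sQ : (Q i <= Q i.+1)%VS.
  apply: addvS => //; apply/subv_sumP => k ki.
  by apply: (sumv_sup k) => //; apply: ltn_trans ki _.
by rewrite !capvA (capv_idPl sQ).
Qed.

End Homology.

(** * Polynomial functions of a matrix and their nonvanishing *)

Section PolynomialFunctions.
Variables (K : fieldType) (n : nat).
Local Notation E := (ext K n).
Implicit Types (g h : 'M[K]_n) (F G : 'M[K]_n -> K).

(** Working with functions avoids writing the polynomials down; the entries are flattened as in
    [zariski_open_GL]. *)
Definition polyfun F : Prop :=
  exists p : {mpoly K[n * n]}, forall g, F g = p.@[fun k => mxvec g 0 k].

Lemma eq_polyfun F G : F =1 G -> polyfun F -> polyfun G.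
Proof. by move=> eFG [p hp]; exists p => g; rewrite -eFG. Qed.

Lemma polyfun_const c : polyfun (fun _ => c).
Proof. by exists (mpolyC _ c) => g; rewrite mevalC. Qed.

Lemma polyfun_entry i j : polyfun (fun g => g i j).
Proof. by exists 'X_(mxvec_index i j) => g; rewrite mevalXU mxvecE. Qed.

Lemma polyfunD F G : polyfun F -> polyfun G -> polyfun (fun g => F g + G g).
Proof. by move=> [p hp] [q hq]; exists (p + q) => g; rewrite mevalD hp hq. Qed.

Lemma polyfunM F G : polyfun F -> polyfun G -> polyfun (fun g => F g * G g).
Proof. by move=> [p hp] [q hq]; exists (p * q) => g; rewrite mevalM hp hq. Qed.

Lemma polyfun_sum I (r : seq I) (P : pred I) (F : I -> 'M[K]_n -> K) :
  (forall i, polyfun (F i)) -> polyfun (fun g => \sum_(i <- r | P i) F i g).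
Proof.
move=> hF; elim: r => [|i r IHr].
  by apply: eq_polyfun (polyfun_const 0) => g; rewrite big_nil.
have [Pi|nPi] := boolP (P i).
  by apply: eq_polyfun (polyfunD (hF i) IHr) => g; rewrite big_cons Pi.
by apply: eq_polyfun IHr => g; rewrite big_cons (negPf nPi).
Qed.

Lemma polyfun_prod I (r : seq I) (P : pred I) (F : I -> 'M[K]_n -> K) :
  (forall i, polyfun (F i)) -> polyfun (fun g => \prod_(i <- r | P i) F i g).
Proof.
move=> hF; elim: r => [|i r IHr].
  by apply: eq_polyfun (polyfun_const 1) => g; rewrite big_nil.
have [Pi|nPi] := boolP (P i).
  by apply: eq_polyfun (polyfunM (hF i) IHr) => g; rewrite big_cons Pi.
by apply: eq_polyfun IHr => g; rewrite big_cons (negPf nPi).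
Qed.

Lemma polyfunX F k : polyfun F -> polyfun (fun g => F g ^+ k).
Proof.
move=> hF; elim: k => [|k IHk]; first exact: polyfun_const.
by apply: eq_polyfun (polyfunM hF IHk) => g; rewrite exprS.
Qed.

Lemma polyfun_det m (F : 'M[K]_n -> 'M[K]_m) :
  (forall i j, polyfun (fun g => F g i j)) -> polyfun (fun g => \det (F g)).
Proof.
move=> hF; apply: polyfun_sum => s; apply: polyfunM; first exact: polyfun_const.
by apply: polyfun_prod => i.
Qed.

Lemma polyfun_mulmx m p q (F : 'M[K]_n -> 'M[K]_(m, p)) (G : 'M[K]_n -> 'M[K]_(p, q)) :
  (forall i j, polyfun (fun g => F g i j)) -> (forall i j, polyfun (fun g => G g i j)) ->
  forall i j, polyfun (fun g => (F g *m G g) i j).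
Proof.
move=> hF hG i j; apply: (@eq_polyfun (fun g => \sum_k F g i k * G g k j)).
  by move=> g; rewrite mxE.
by apply: polyfun_sum => k; apply: polyfunM.
Qed.

Lemma polyfun_subst x A : polyfun (fun g => coord (subst g x) A).
Proof.
have pM (X Y : 'M[K]_n -> E) : (forall B, polyfun (fun g => coord (X g) B)) ->
    (forall B, polyfun (fun g => coord (Y g) B)) ->
    forall B, polyfun (fun g => coord (X g * Y g) B).
  move=> hX hY B.
  apply: (@eq_polyfun (fun g => \sum_(C : {set 'I_n} | C \subset B)
     esign K C (B :\: C) * coord (X g) C * coord (Y g) (B :\: C))).
    by move=> g; rewrite coordM.
  by apply: polyfun_sum => C; do 2![apply: polyfunM => //]; apply: polyfun_const.
have pV l B : polyfun (fun g => coord (vsval (change_vars g l)) B).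
  apply: (@eq_polyfun (fun g => \sum_k g k l * coord (mon [set k] : E) B)).
    move=> g; rewrite /change_vars linear_sum /= coord_sum.
    by apply: eq_bigr => k _; rewrite coordZ.
  by apply: polyfun_sum => k; apply: polyfunM; [apply: polyfun_entry | apply: polyfun_const].
have pP s B : polyfun (fun g => coord (\prod_(i <- s) vsval (change_vars g i)) B).
  elim: s B => [|i s IHs] B.
    apply: (@eq_polyfun (fun _ => coord (1 : E) B)); last exact: polyfun_const.
    by move=> g; rewrite big_nil.
  apply: (@eq_polyfun (fun g => coord (vsval (change_vars g i) *
     \prod_(i <- s) vsval (change_vars g i)) B)) => [g|]; first by rewrite big_cons.
  exact: pM.
apply: (@eq_polyfun (fun g => \sum_(B : {set 'I_n}) coord x B *
   coord (\prod_(i <- enum B) vsval (change_vars g i)) A)) => [g|].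
  by rewrite lfunE /= /subst_fun coord_sum; apply: eq_bigr => B _; rewrite coordZ.
by apply: polyfun_sum => B; apply: polyfunM => //; apply: polyfun_const.
Qed.

Lemma polyfun_adj i j : polyfun (fun g => (\adj g) i j).
Proof.
apply: (@eq_polyfun (fun g => cofactor g j i)) => [g|]; first by rewrite mxE.
apply: polyfunM; first exact: polyfun_const.
apply: polyfun_det => k l; apply: eq_polyfun (polyfun_entry (lift j k) (lift i l)) => g.
by rewrite !mxE.
Qed.

(* The exponent [N] clears the denominators of the entries of [invmx g]. *)
Lemma polyfun_invmx (p : {mpoly K[n * n]}) :
  exists N (q : {mpoly K[n * n]}), forall g, g \in unitmx ->
    q.@[fun k => mxvec g 0 k] = \det g ^+ N * p.@[fun k => mxvec (invmx g) 0 k].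
Proof.
have [] : polyfun (fun g => \sum_(m <- msupp p) p@_m * (\det g ^+ (msize p - mdeg m)
             * \prod_i (mxvec (\adj g) 0 i) ^+ m i)).
  apply: polyfun_sum => m; apply: polyfunM; first exact: polyfun_const.
  apply: polyfunM; first by apply/polyfunX/polyfun_det => i j; apply: polyfun_entry.
  apply: polyfun_prod => k; apply: polyfunX; case/mxvec_indexP: k => i j.
  by apply: eq_polyfun (polyfun_adj i j) => g; rewrite mxvecE.
move=> q hq; exists (msize p), q => g gU; rewrite -hq mevalE mulr_sumr.
apply: eq_big_seq => m hm; rewrite [RHS]mulrCA; congr (_ * _).
have d0 : \det g != 0 by rewrite -unitfE -unitmxE.
rewrite /invmx gU [in RHS](eq_bigr (fun i =>
  (\det g)^-1 ^+ m i * (mxvec (\adj g) 0 i) ^+ m i)); last first.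
  by move=> i _; case/mxvec_indexP: i => a b; rewrite !mxvecE mxE exprMn.
rewrite big_split /= mulrA; congr (_ * _).
rewrite prodrXr -mdegE exprVn -expfB_cond ?(negPf d0) //.
by apply: ltnW; apply: msize_mdeg_lt.
Qed.

(** Parameter [0] gives [g] and parameter [1] gives [h], which reduces nonvanishing to polynomials
    in one variable. *)
Lemma polyfun_line (p : {mpoly K[n * n]}) g h : exists u : {poly K}, forall t,
  u.[t] = p.@[fun k => mxvec (g + t *: (h - g)) 0 k].
Proof.
exists (\sum_(m <- msupp p) (p@_m)%:P * \prod_i
  ((mxvec g 0 i)%:P + (mxvec (h - g) 0 i) *: 'X) ^+ m i) => t.
rewrite mevalE horner_sum; apply: eq_bigr => m _.
rewrite hornerM hornerC horner_prod; congr (_ * _); apply: eq_bigr => i _.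
rewrite horner_exp !hornerE; congr (_ ^+ _).
by case/mxvec_indexP: i => a b; rewrite !mxvecE !mxE; congr (_ + _); rewrite mulrC.
Qed.

Hypothesis K_infinite : cardinality.infinite_set (@classical_sets.setT K).

(** A nonzero [u] has fewer than [size u] roots, while an infinite field has [size u] distinct
    elements. *)
Lemma poly_nonroot (u : {poly K}) : u != 0 -> exists t, u.[t] != 0.
Proof.
move=> u0; have [B _ hB] := cardinality.infinite_set_fset (size u) K_infinite.
have [/allP allB|/allPn[t _ ht]] := boolP (all (root u) (finmap.enum_fset B)).
  have := max_poly_roots u0 (introT allP allB) (finmap.fset_uniq B).
  by rewrite ltnNge; move: hB; rewrite finmap.cardfE => ->.
by exists t.
Qed.

(* Restrict both functions to the line through [g] and [h]. *)
Lemma polyfun_nonzeroM F G : polyfun F -> polyfun G ->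
  (exists g, F g != 0) -> (exists h, G h != 0) -> exists g, F g * G g != 0.
Proof.
move=> [p hp] [q hq] [g Fg] [h Gh].
have [u hu] := polyfun_line p g h; have [w hw] := polyfun_line q g h.
have u0 : u != 0.
  apply: contraNneq Fg => u0; have := hu 0.
  by rewrite u0 horner0 scale0r addr0 -hp => <-.
have w0 : w != 0.
  apply: contraNneq Gh => w0; have := hw 1.
  by rewrite w0 horner0 scale1r addrC subrK -hq => <-.
have [t] := poly_nonroot (mulf_neq0 u0 w0); rewrite hornerM hu hw -hp -hq.
by exists (g + t *: (h - g)).
Qed.

Lemma polyfun_nonzero_prod I (r : seq I) (F : I -> 'M[K]_n -> K) :
  (forall i, polyfun (F i)) -> (forall i, exists g, F i g != 0) ->
  exists g, \prod_(i <- r) F i g != 0.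
Proof.
move=> pF nF; elim: r => [|i r IHr]; first by exists 0; rewrite big_nil oner_neq0.
have [g hg] := polyfun_nonzeroM (pF i) (polyfun_prod r predT pF) (nF i) IHr.
by exists g; rewrite big_cons.
Qed.

End PolynomialFunctions.

(** * Generic ranks and existence of the generic initial ideal *)

Section GenericInitialIdeal.
Import VectorInternalTheory.
Variables (K : fieldType) (n : nat).
Local Notation E := (ext K n).
Implicit Types (g h : 'M[K]_n) (J W : {vspace E}).

(** [R] is the largest rank attained at an invertible matrix, and [q] is a determinant of size [R]
    whose nonvanishing forces rank at least [R]. *)
Lemma generic_rank m p (F : 'M[K]_n -> 'M[K]_(m, p)) :
  (forall i j, polyfun (fun g => F g i j)) ->
  exists q R, [/\ polyfun q, exists2 g, g \in unitmx & q g != 0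
    & forall g, g \in unitmx -> q g != 0 -> \rank (F g) = R].
Proof.
move=> pF; pose P r := boolp.asbool (exists2 g, g \in unitmx & \rank (F g) = r).
have exP : exists r, P r.
  by exists (\rank (F 1%:M)); apply/boolp.asboolP; exists 1%:M; rewrite ?unitmx1.
have bP r : P r -> (r <= m)%N by move=> /boolp.asboolP[g _ <-]; apply: rank_leq_row.
case: (ex_maxnP exP bP) => R /boolp.asboolP[g0 g0U e0] maxR.
(* [A] and [B] invert the two factors of a full-rank factorization of [F g0]. *)
have /row_fullP[A hA] := col_base_full (F g0).
have /row_freeP[B hB] := row_base_free (F g0).
exists (fun g => \det (A *m F g *m B)), R; split.
- by apply: polyfun_det; do 2?[apply: polyfun_mulmx => //]; move=> *; apply: polyfun_const.
- exists g0 => //; have -> : A *m F g0 *m B = (A *m col_base (F g0)) *m (row_base (F g0) *m B).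
    by rewrite mulmxA -(mulmxA A (col_base _)) mulmx_base.
  by rewrite hA hB mul1mx det1 oner_neq0.
move=> g gU q0; apply/eqP; rewrite eqn_leq maxR; last by apply/boolp.asboolP; exists g.
(* The product with [A] and [B] is an invertible square matrix of size [R], and its rank is at most
   that of [F g]. *)
rewrite -e0 -(mxrank_unit (_ : A *m F g *m B \in unitmx)); last by rewrite unitmxE unitfE.
exact: leq_trans (mxrankM_maxl _ _) (mxrankM_maxr _ _).
Qed.

Lemma dim_span_rank (V : vectType K) m (X : m.-tuple V) :
  \dim <<X>> = \rank (\matrix_i v2r (tnth X i)).
Proof.
rewrite /dimv [@span _ _]unlock genmxE tvalK -/(b2mx X).
(* The span retypes [X] with its size as length; this eliminates the resulting cast. *)
by case: _ / (esym _).
Qed.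

(** The dimension is the rank of the matrix whose rows are the images of a fixed basis of [J], with
    entries polynomial in [g]. *)
Lemma generic_dim_restr J S : exists q R, [/\ polyfun q, exists2 g, g \in unitmx & q g != 0
  & forall g : 'M[K]_n, g \in unitmx -> q g != 0 -> \dim (restr K S @: (subst g @: J)) = R].
Proof.
pose y g i := restr K S (subst g (tnth (vbasis J) i)).
pose F g := \matrix_i v2r (y g i).
have e g : \dim (restr K S @: (subst g @: J)) = \rank (F g).
  rewrite -{1}(span_basis (vbasisP J)) !limg_span -map_comp.
  rewrite (dim_span_rank (map_tuple _ (vbasis J))); congr (\rank _).
  by apply/matrixP => i j; rewrite !mxE tnth_map.
have [i j|q [R [pq nq hq]]] := @generic_rank _ _ F; last first.
  by exists q, R; split=> // g gU qg; rewrite e hq.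
(* [v2r] need not use the monomial basis, so each entry is expanded as a constant combination of
   monomial coordinates. *)
apply: (@eq_polyfun _ _ (fun g => \sum_(A in S) coord (subst g (tnth (vbasis J) i)) A *
   v2r (mon A : E) 0 j)) => [g|].
  rewrite !mxE /y [restr K S _]ext_sum_mon linear_sum summxE.
  rewrite big_mkcond /=; apply: eq_bigr => A _; rewrite linearZ mxE coord_restr.
  by case: ifP; rewrite ?mul0r.
by apply: polyfun_sum => A; apply: polyfunM; [apply: polyfun_subst | apply: polyfun_const].
Qed.

(** The sets [S] of monomials at least [A] in its degree, and [S :\ A], are both upper; the
    difference of the two dimensions tells whether [A] is initial. *)
Lemma initial_mons_dim W1 W2 : gradedv W1 -> gradedv W2 ->
  (forall S, \dim (restr K S @: W1) = \dim (restr K S @: W2)) ->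
  initial_mons W1 = initial_mons W2.
Proof.
move=> g1 g2 h; apply/setP => A.
pose S := [set B : {set 'I_n} | (#|B| == #|A|) && ((B == A) || rlex_lt A B)].
have hS B : B \in S -> #|B|%:Z = #|A| by rewrite inE => /andP[/eqP ->].
have uS : rlex_upper S.
  move=> B C; rewrite !inE => /andP[/eqP cB hB] ltBC; have /rlex_ltP[cBC _] := ltBC.
  rewrite -cBC cB eqxx; case/orP: hB => [/eqP <-|ltAB]; first by rewrite ltBC orbT.
  by rewrite (rlex_lt_trans ltAB) ?orbT.
have uS' : rlex_upper (S :\ A).
  move=> B C; rewrite in_setD1 => /andP[nBA BS] ltBC; rewrite in_setD1 (uS _ _ BS) // andbT.
  apply/eqP => eC; move: BS; rewrite inE (negPf nBA) /= => /andP[_ ltAB].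
  by have := rlex_lt_trans ltAB ltBC; rewrite eC rlex_lt_irr.
have hS' B : B \in S :\ A -> #|B|%:Z = #|A| by rewrite in_setD1 => /andP[_ /hS].
have := h S; have := h (S :\ A).
rewrite !(dim_restr _ hS) ?(dim_restr _ hS') // => e'.
have AS : A \in S by rewrite inE !eqxx.
have e I : #|S :&: I| = ((A \in I) + #|(S :\ A) :&: I|)%N.
  by rewrite (cardsD1 A) inE AS /= setIDAC.
rewrite !e e' => /eqP; rewrite eqn_add2r.
by case: (A \in _) (A \in _) => [] [].
Qed.

Hypothesis K_infinite : cardinality.infinite_set (@classical_sets.setT K).

Lemma is_gin_exists J : gradedv J -> exists I, is_gin J I.
Proof.
move=> gJ.
have /fin_all_exists2 [q hq hR] : forall S : {set {set 'I_n}}, exists2 q : 'M[K]_n -> K,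
    (polyfun q /\ exists2 g, g \in unitmx & q g != 0) & exists R,
    forall g : 'M[K]_n, g \in unitmx -> q g != 0 -> \dim (restr K S @: (subst g @: J)) = R.
  by move=> S; have [q [R [? ? ?]]] := generic_dim_restr J S; exists q => //; exists R.
(* The determinant enters so that the common point [g0] of nonvanishing is invertible. *)
have [g0] : exists g, \prod_(S : {set {set 'I_n}}) (\det g * q S g) != 0.
  apply: polyfun_nonzero_prod => // S; have [pq [g gU qg]] := hq S.
    by apply: polyfunM => //; apply: polyfun_det => i j; apply: polyfun_entry.
  by exists g; rewrite mulf_neq0 // -unitfE -unitmxE.
move=> /prodf_neq0 h0.
have g0U : g0 \in unitmx.
  by have := h0 set0 isT; rewrite mulf_eq0 negb_or unitmxE unitfE => /andP[].
have q0 S : q S g0 != 0 by have := h0 S isT; rewrite mulf_eq0 negb_or => /andP[].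
exists (initial_ideal (subst g0 @: J)).
exists (fun g => g \in unitmx /\ \prod_S q S g != 0); split.
- have [p hp] : polyfun (fun g => \prod_S q S g) by apply: polyfun_prod => S; case: (hq S).
  exists (eq p) => g; rewrite hp; split=> -[gU]; first by move=> h; split=> //; exists p.
  by case=> _ <-.
- by exists g0; split=> //; apply/prodf_neq0 => S _.
move=> g [gU /prodf_neq0 qg].
have e : initial_mons (subst g @: J) = initial_mons (subst g0 @: J).
  apply: initial_mons_dim; try exact: gradedv_subst.
  by move=> S; have [R hRS] := hR S; rewrite !hRS ?qg.
by rewrite /initial_ideal e.
Qed.

End GenericInitialIdeal.

(** * Inversion of open sets and the comparison of annihilator numbers *)

Lemma zariski_open_GL_invmx (K : fieldType) (n : nat) (U : 'M[K]_n -> Prop) :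
  zariski_open_GL U -> zariski_open_GL (fun g => g \in unitmx /\ U (invmx g)).
Proof.
(* The equations are pulled back along inversion and multiplied by a power of the determinant, which
   is nonzero on invertible matrices. *)
move=> [S hU]; exists (fun q => exists2 p, S p & exists N, forall g : 'M[K]_n, g \in unitmx ->
  q.@[fun k => mxvec g 0 k] = \det g ^+ N * p.@[fun k => mxvec (invmx g) 0 k]) => g.
split=> -[gU].
  move=> /hU[_ [p Sp hp]]; split=> //; have [N [q hq]] := polyfun_invmx p.
  exists q; first by exists p => //; exists N.
  by rewrite hq // mulf_neq0 // expf_neq0 // -unitfE -unitmxE.
move=> [q [p Sp [N hq]]]; rewrite hq // mulf_eq0 negb_or => /andP[_ hp].
by split=> //; apply/hU; rewrite unitmx_inv; split=> //; exists p.
Qed.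

Theorem theorem3p5 (K : fieldType) (n : nat)
    (K_infinite : cardinality.infinite_set (@classical_sets.setT K))
    (J : gideal K n) :
  exists U : 'M[K]_n -> Prop,
    [/\ zariski_open_GL U, exists g, U g
      & forall g : 'M[K]_n, U g -> forall (i : 'I_n) (j : int),
          annihilator_number (change_vars g) (quotM J) i j =
          annihilator_number evar (quotM (gin J)) i j].
Proof.
have gJ := gsubmod_gradedv J.
(* [gin_vs] falls back to zero only if no generic initial ideal exists, which [is_gin_exists]
   excludes. *)
have [U [oU [h Uh] hU]] : is_gin (J : {vspace ext K n}) (gin_vs J).
  rewrite /gin_vs; case: classical_sets.xgetP => [I _ //|noI].
  by have [I /noI] := is_gin_exists K_infinite gJ.
(* The change of coordinates taking the new forms back to the variables is [invmx g], so it is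
   [invmx g] that must be generic for [J]. *)
exists (fun g => g \in unitmx /\ U (invmx g)); split.
- exact: zariski_open_GL_invmx.
- have hunit : h \in unitmx by have [S hS] := oU; have /hS[] := Uh.
  by exists (invmx h); rewrite unitmx_inv invmxK.
move=> g [gU Ug] i j; rewrite !annihilator_number_hilb.
pose W : {vspace ext K n} := (subst (invmx g) @: (J : {vspace ext K n}))%VS.
have eJ : (J : {vspace ext K n}) = (subst g @: W)%VS.
  rewrite -limg_comp; apply/vspaceP => x; apply/idP/memv_imgP => [xJ|[y yJ ->]].
    by exists x; rewrite // comp_lfunE subst_comp mulmxV // subst1.
  by rewrite comp_lfunE subst_comp mulmxV // subst1.
have idW (a x : ext K n) : x \in W -> a * x \in W.
  (* Writing [a] as an image under [subst (invmx g)] moves the product back into [J]. *)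
  move=> /memv_imgP[y yJ ->]; rewrite -[a]subst1 -(mulVmx gU) -subst_comp -substM.
  by rewrite memv_img // gsubmod_mull.
have e k l : hilb ((J : {vspace ext K n}) + var_span (change_vars g) k) l =
             hilb ((gin J : {vspace ext K n}) + var_span evar k) l.
  (* Undo the change of variables, pass from [W] to its initial ideal, and use that [invmx g] lies
     in [U]. *)
  rewrite eJ hilb_subst // -(@hilb_initial_ideal _ _ W) //; last exact: gradedv_subst.
  by rewrite /= /W (hU _ Ug).
by rewrite !e.
Qed.
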